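(* Let $\mathbf{p} = (p_1, \ldots, p_m)$ be a given $m$-tuple of real polynomials from $\mathcal{P}_n$, and let $$\theta_{\mathbf{p}}(t) = (1 + t_1^2 + \cdots + t_n^2 + p_1(t)^2 + \cdots + p_m(t)^2)^{-1}, \quad t \in \mathbf{R}^n.$$ Denote by $\mathcal{R}_{\theta_{\mathbf{p}}}$ the $\mathbf{C}$-algebra (of functions on $\mathbf{R}^n$) generated by $\mathcal{P}_n$ and $\theta_{\mathbf{p}}$. Let $\Lambda : \mathcal{R}_{\theta_{\mathbf{p}}} \to \mathbf{C}$ be a positive semi-definite map such that $\Lambda(p_k|r|^2) \geq 0$ for all $r \in \mathcal{R}_{\theta_{\mathbf{p}}}$ and $k = 1, \ldots, m$. Then $\Lambda$ has a uniquely determined representing measure $\mu$ whose support is in the set $\bigcap_{k=1}^m p_k^{-1}(\mathbf{R}_+)$. Moreover, the algebra $\mathcal{R}_{\theta_{\mathbf{p}}}$ is dense in $L^2(\mu)$.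
   Context: $n \ge 1$ is a fixed integer; $\mathcal{P}_n = \mathbf{C}[t]$, $t=(t_1,\ldots,t_n)$, is the algebra of all polynomial functions on $\mathbf{R}^n$ with complex coefficients; $\mathbf{R}_+ = [0,\infty)$. Let $\mathcal{R}$ be an algebra of complex-valued functions on $\mathbf{R}^n$ containing the constant function $1$ and closed under complex conjugation. A linear map $L : \mathcal{R} \to \mathbf{C}$ is positive semi-definite if $L(f\bar f) \ge 0$ for all $f \in \mathcal{R}$; such a map is always assumed to be nondegenerate, i.e. $L(1) > 0$. A representing measure for $L$ is a positive Borel measure $\mu$ on $\mathbf{R}^n$ such that $\mathcal{R} \subset L^2(\mu)$ and $L(f) = \int f\, d\mu$ for all $f \in \mathcal{R}$. *)

(* Defs.v *)
From mathcomp Require Import all_boot all_order all_algebra.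
From mathcomp Require mpoly.
From mathcomp Require Import complex.
From mathcomp Require Import all_classical all_reals all_analysis.

Set Implicit Arguments.
Unset Strict Implicit.
Unset Printing Implicit Defensive.

Import Order.TTheory GRing.Theory Num.Theory.
Import numFieldNormedType.Exports.
Import ComplexField.

Local Open Scope classical_set_scope.
Local Open Scope ring_scope.
Local Open Scope complex_scope.

Section FunctionAlgebras.
Variables (R : rcfType) (T : Type).
Implicit Types (f g : T -> R[i]) (A G : set (T -> R[i])).

Definition is_subalgebra A : Prop :=
  [/\ A (fun=> 1),
      forall a f g, A f -> A g -> A (fun t => a * f t + g t)
    & forall f g, A f -> A g -> A (fun t => f t * g t)].

Definition generated_algebra G : set (T -> R[i]) := smallest is_subalgebra G.

(* A map on [A] is encoded as a total map whose values outside [A] are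
   irrelevant: they are never constrained nor used. *)
Definition linear_on A (L : (T -> R[i]) -> R[i]) : Prop :=
  forall a f g, A f -> A g -> L (fun t => a * f t + g t) = a * L f + L g.

(* In the order of [R[i]], [0 <= z] means that [z] is real and nonnegative. *)
Definition psd_map A (L : (T -> R[i]) -> R[i]) : Prop :=
  [/\ linear_on A L,
      forall f, A f -> 0 <= L (fun t => f t * (f t)^*)
    & 0 < L (fun=> 1)].

End FunctionAlgebras.

Section Polynomials.
Variables (R : realType) (n : nat).

Definition real_mpoly_fun (p : mpoly.mpoly n R) (t : 'rV[R]_n) : R :=
  mpoly.meval (fun j => t ord0 j) p.

Definition complex_mpoly_fun (p : mpoly.mpoly n R[i]) (t : 'rV[R]_n) : R[i] :=
  mpoly.meval (fun j => (t ord0 j)%:C) p.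

Definition polynomial_functions : set ('rV[R]_n -> R[i]) :=
  range complex_mpoly_fun.

Definition theta m (p : m.-tuple (mpoly.mpoly n R)) (t : 'rV[R]_n) : R :=
  (1 + \sum_(j < n) t ord0 j ^+ 2
     + \sum_(k < m) real_mpoly_fun (tnth p k) t ^+ 2)^-1.

Definition R_theta m (p : m.-tuple (mpoly.mpoly n R)) :
    set ('rV[R]_n -> R[i]) :=
  generated_algebra
    (polynomial_functions `|` [set (fun t => (theta p t)%:C)]).

End Polynomials.

Definition borelRn (R : realType) (n : nat) :
    measurableType (sigma_display (@open 'rV[R]_n)) :=
  g_sigma_algebraType (@open 'rV[R]_n).

Section BorelMeasures.
Variables (R : realType) (n : nat).
Local Notation B := (borelRn R n).
Implicit Types (mu : {measure set B -> \bar R}) (f : 'rV[R]_n -> R[i]).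

Definition complex_measurable f : Prop :=
  measurable_fun setT (fun t : B => complex.Re (f t)) /\
  measurable_fun setT (fun t : B => complex.Im (f t)).

(* The seminorm is on functions: [L2 mu] is not quotiented by a.e. equality. *)
Definition L2norm mu f : \bar R :=
  Lnorm mu 2%:E (fun t : B => (Normc.normc (f t))%:E).

Definition L2 mu : set ('rV[R]_n -> R[i]) :=
  [set f | complex_measurable f /\ (L2norm mu f < +oo)%E].

Definition complex_integral mu f : R[i] :=
  Complex (Rintegral mu setT (fun t : B => complex.Re (f t)))
          (Rintegral mu setT (fun t : B => complex.Im (f t))).

Definition representing_measure (A : set ('rV[R]_n -> R[i]))
    (L : ('rV[R]_n -> R[i]) -> R[i]) mu : Prop :=
  A `<=` L2 mu /\ forall f, A f -> L f = complex_integral mu f.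

Definition msupport mu : set 'rV[R]_n :=
  [set x | forall U : set 'rV[R]_n, open U -> U x -> (0 < mu U)%E].

Definition dense_in_L2 mu (A : set ('rV[R]_n -> R[i])) : Prop :=
  A `<=` L2 mu /\
  forall g, L2 mu g -> forall e : R, 0 < e ->
    exists2 f, A f & (L2norm mu (fun t => (g t - f t)%R) < e%:E)%E.

End BorelMeasures.

(* Main.v *)
(** Put [D = 1 + |t|^2 + |p(t)|^2 = 1 / theta]. In the real algebra [A]
    generated by the polynomials and [theta], the functions [Y_0 = theta],
    [Y_j = (1 + 2 theta t_j) / 2] and all the [1 - Y_i] are sums of squares,
    and sums of squares are closed under products. So the real part [l] of
    [Lambda] is nonnegative on the products of the [Y_i] and [1 - Y_i], and
    the numbers [l (\prod_r 'C(k_r, d_r) Y^d_r (1 - Y)^(k_r - d_r))] are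
    consistent masses of words [d_0, d_1, ...]. They are realized as the law of
    a sequence of digits on an interval with Lebesgue measure, on which, as in
    de Finetti's theorem, the frequencies [d_r / k_r] converge almost surely to
    random variables [X_i] with [E (\prod_i X_i) = l (\prod_i Y_i)].

    Almost surely [X_0 > 0], since [(j + 1) l ((1 - theta)^j) <= l D]; the law
    of [tau = ((X_j - 1/2) / X_0)_j] is the representing measure. The identity
    [E f(tau) = l f] is known for polynomials in the [Y_i] and passes to
    [D^K q(Y)] by induction on [K], replacing [f] by [f (1 - (1 - theta)^j)].

    For any finite Borel measure, the functions that are square approximable by
    polynomials in the [Y_i] form an algebra closed under bounded limits. Sign
    functions being limits of polynomials, it contains the indicators of half
    spaces, hence of all Borel sets. This gives density; uniqueness follows by
    applying it to the sum of two representing measures, and the support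
    condition by testing [l (p_k (theta a)^2) >= 0] with [a] close to the
    indicator of [p_k < 0]. *)

Require Import Defs.
From mathcomp Require Import all_boot all_order all_algebra.
From mathcomp Require mpoly.
From mathcomp Require Import complex.
From mathcomp Require Import all_classical all_reals all_analysis.
From mathcomp Require Import measurable_realfun.
From mathcomp Require Import ring lra.
Import numFieldNormedType.Exports.
Import Order.TTheory GRing.Theory Num.Theory.
Local Open Scope classical_set_scope.
Local Open Scope ring_scope.
Local Open Scope complex_scope.
Set Implicit Arguments.
Unset Strict Implicit.
Unset Printing Implicit Defensive.
Import HBNNSimple.

(** * Bounded measurable functions on a finite measure space *)

Section FiniteMeasure.
Context d (T : measurableType d) (R : realType).
Variable P : {measure set T -> \bar R}.
Hypothesis Pfin : (P setT < +oo)%E.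

Definition bmeas (f : T -> R) :=
  measurable_fun setT f /\ exists M : R, forall x, `|f x| <= M.

Lemma bmeas_cst c : bmeas (fun=> c).
Proof. by split; [exact: measurable_cst | exists `|c|]. Qed.

Lemma bmeasD f g : bmeas f -> bmeas g -> bmeas (fun x => f x + g x).
Proof.
move=> [mf [M hM]] [mg [N hN]]; split; first exact: measurable_funD.
by exists (M + N) => x; rewrite (le_trans (ler_normD _ _))// lerD.
Qed.

Lemma bmeasM f g : bmeas f -> bmeas g -> bmeas (fun x => f x * g x).
Proof.
move=> [mf [M hM]] [mg [N hN]]; split; first exact: measurable_funM.
by exists (M * N) => x; rewrite normrM ler_pM.
Qed.

Lemma bmeasZ c f : bmeas f -> bmeas (fun x => c * f x).
Proof. by move=> hf; apply: (bmeasM (bmeas_cst c)). Qed.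

Lemma bmeasN f : bmeas f -> bmeas (fun x => - f x).
Proof.
by move=> /(bmeasZ (-1)); congr bmeas; apply/funext => x; rewrite mulN1r.
Qed.

Lemma bmeasB f g : bmeas f -> bmeas g -> bmeas (fun x => f x - g x).
Proof. by move=> hf /bmeasN; exact: bmeasD. Qed.

Lemma bmeasX f n : bmeas f -> bmeas (fun x => f x ^+ n).
Proof.
move=> hf; elim: n => [|n IH]; first exact: bmeas_cst.
by have := bmeasM hf IH; congr bmeas; apply/funext => x; rewrite exprS.
Qed.

Lemma bmeas_sum (I : Type) (s : seq I) (h : I -> T -> R) :
  (forall i, bmeas (h i)) -> bmeas (fun x => \sum_(i <- s) h i x).
Proof.
move=> hh; elim: s => [|i s IH].
  by under eq_fun do rewrite big_nil; exact: bmeas_cst.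
by under eq_fun do rewrite big_cons; exact: bmeasD.
Qed.

Lemma bmeas_prod (I : Type) (s : seq I) (h : I -> T -> R) :
  (forall i, bmeas (h i)) -> bmeas (fun x => \prod_(i <- s) h i x).
Proof.
move=> hh; elim: s => [|i s IH].
  by under eq_fun do rewrite big_nil; exact: bmeas_cst.
by under eq_fun do rewrite big_cons; exact: bmeasM.
Qed.

Lemma bmeas_indic A : measurable A -> bmeas \1_A.
Proof.
move=> mA; split; first exact: measurable_indic.
by exists 1 => x; rewrite indicE; case: (_ \in _); rewrite ?normr1// normr0.
Qed.

Lemma bmeas_integrable f : bmeas f -> P.-integrable setT (EFin \o f).
Proof.
move=> [mf [M hM]]; apply: measurable_bounded_integrable => //.
exists M; split; first by rewrite num_real.
by move=> y My x _; exact: le_trans (hM x) (ltW My).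
Qed.

Lemma RintegralZ c f : P.-integrable setT (EFin \o f) ->
  \int[P]_x (c * f x) = c * \int[P]_x f x.
Proof. by move=> hf; rewrite RintegralZl. Qed.

Lemma Rintegral_sum (I : Type) (s : seq I) (h : I -> T -> R) :
  (forall i, bmeas (h i)) ->
  \int[P]_x (\sum_(i <- s) h i x) = \sum_(i <- s) \int[P]_x h i x.
Proof.
move=> hh; elim: s => [|i s IH].
  by under eq_Rintegral do rewrite big_nil; rewrite big_nil Rintegral_cst// mul0r.
under eq_Rintegral do rewrite big_cons.
by rewrite big_cons RintegralD ?IH//; apply: bmeas_integrable => //; exact: bmeas_sum.
Qed.

Lemma Rintegral_indic A : measurable A -> \int[P]_x (\1_A x) = fine (P A).
Proof. by move=> mA; rewrite /Rintegral integral_indic// setIT. Qed.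

Lemma Rintegral_sqrB f g : bmeas f -> bmeas g ->
  \int[P]_x ((f x - g x) ^+ 2) =
  \int[P]_x (f x ^+ 2) + \int[P]_x (g x ^+ 2) - 2 * \int[P]_x (f x * g x).
Proof.
move=> bf bg.
have i1 := bmeas_integrable (bmeasX 2 bf).
have i2 := bmeas_integrable (bmeasX 2 bg).
have i12 := bmeas_integrable (bmeasD (bmeasX 2 bf) (bmeasX 2 bg)).
have i3 := bmeas_integrable (bmeasM bf bg).
have i4 := bmeas_integrable (bmeasZ 2 (bmeasM bf bg)).
rewrite -RintegralZ// -RintegralD// -RintegralB//.
by apply: eq_Rintegral => x _; ring.
Qed.

(** Dominated convergence; the constant bound [M] is integrable because [P] is finite. *)
Lemma bounded_cvg_Rintegral (f : nat -> T -> R) (g : T -> R) (M : R) :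
  (forall n, measurable_fun setT (f n)) -> measurable_fun setT g ->
  (forall n x, `|f n x| <= M) ->
  {ae P, forall x, f ^~ x @ \oo --> g x} ->
  (fun n => \int[P]_x f n x) @ \oo --> \int[P]_x g x.
Proof.
move=> mf mg hM fg.
have mE (h : T -> R) : measurable_fun setT h -> measurable_fun setT (EFin \o h).
  by move=> ?; exact/measurable_EFinP.
have ae1 : {ae P, forall x, setT x ->
    (fun n => (EFin \o f n) x) @ \oo --> (EFin \o g) x}.
  by apply: filterS fg => x fgx _; apply: cvg_EFin => //; exact: nearW.
have ae2 : {ae P, forall x n, setT x -> (`|(EFin \o f n) x| <= cst M%:E x)%E}.
  by apply: aeW => x n _ /=; rewrite lee_fin.
have [ig _ h] := @dominated_convergence _ T R P setT measurableT
  (fun n => EFin \o f n) (EFin \o g) (cst M%:E)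
  (fun n => mE _ (mf n)) (mE _ mg) ae1 (bmeas_integrable (bmeas_cst M)) ae2.
by apply: fine_cvg; rewrite fineK; last exact: integrable_fin_num.
Qed.

End FiniteMeasure.

(** * Random digits with prescribed word masses *)

(* Words are listed with the latest digit first. The cells of the words of a
   given length are consecutive intervals, each split by its children. *)
Section Digits.
Variables (R : realType) (k : nat -> nat) (mass : seq nat -> R).
Hypothesis mass_ge0 : forall w, 0 <= mass w.
Hypothesis mass_children :
  forall w, mass w = \sum_(0 <= d < (k (size w)).+1) mass (d :: w).

Fixpoint lend w : R :=
  if w is d :: w' then lend w' + \sum_(0 <= i < d) mass (i :: w') else 0.

Definition cell w : set R := `[lend w, lend w + mass w[.

Fixpoint words r : seq (seq nat) :=
  if r is r'.+1 then [seq d :: w | w <- words r', d <- iota 0 (k r').+1]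
  else [:: [::]].

Definition word_digit w u :=
  find (fun d => u < lend (d.+1 :: w)) (iota 0 (k (size w)).+1).

Fixpoint word r u :=
  if r is r'.+1 then word_digit (word r' u) u :: word r' u else [::].

Lemma lendS d w : lend (d.+1 :: w) = lend (d :: w) + mass (d :: w).
Proof. by rewrite /= big_nat_recr //= addrA. Qed.

Lemma lend0 w : lend (0%N :: w) = lend w.
Proof. by rewrite /= big_geq // addr0. Qed.

(** Consistency of the masses makes the children tile the cell of their parent: the right end of the
    last child is the right end of the parent. *)
Lemma lend_last w : lend ((k (size w)).+1 :: w) = lend w + mass w.
Proof. by rewrite [mass w]mass_children. Qed.

Lemma lend_homo w d e : (d <= e)%N -> lend (d :: w) <= lend (e :: w).
Proof.
move=> /subnKC <-; elim: (e - d)%N => [|m IH]; first by rewrite addn0.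
by rewrite addnS lendS (le_trans IH)// lerDl.
Qed.

Lemma size_word r u : size (word r u) = r.
Proof. by elim: r => //= r ->. Qed.

Lemma cellE w u : cell w u <-> lend w <= u < lend w + mass w.
Proof. by rewrite /cell /= in_itv. Qed.

Lemma cell_cons d w u : cell (d :: w) u <-> lend (d :: w) <= u < lend (d.+1 :: w).
Proof. by rewrite cellE lendS. Qed.

Lemma cell_child d w : (d < (k (size w)).+1)%N -> cell (d :: w) `<=` cell w.
Proof.
move=> dk u /cell_cons/andP[h1 h2]; apply/cellE; apply/andP; split.
  by rewrite (le_trans _ h1)// -lend0 lend_homo.
by rewrite (lt_le_trans h2)// -lend_last lend_homo.
Qed.

Lemma word_digitP w u : cell w u ->
  (word_digit w u < (k (size w)).+1)%N /\ cell (word_digit w u :: w) u.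
Proof.
move=> /cellE/andP[h1 h2].
set p := fun d => u < lend (d.+1 :: w).
have hp : has p (iota 0 (k (size w)).+1).
  apply/hasP; exists (k (size w)); first by rewrite mem_iota ltnS leqnn.
  by rewrite /p lend_last.
have lt : (word_digit w u < (k (size w)).+1)%N.
  by move: hp; rewrite has_find size_iota.
split=> //; apply/cell_cons; apply/andP; split; last first.
  by have := nth_find 0%N hp; rewrite nth_iota.
(* Digit 0 starts where the parent starts; for a positive digit, minimality of [find] says that the
   preceding sibling ends at or before [u]. *)
case E : (word_digit w u) => [|d]; first by rewrite lend0.
have := @before_find _ 0%N p (iota 0 (k (size w)).+1) d.
rewrite -/(word_digit w u) E nth_iota; last by rewrite -ltnS -E ltnW.
by move=> /(_ (ltnSn _)) /negbT; rewrite /p -leNgt.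
Qed.

Lemma word_digit_uniq w u d : cell w u -> cell (d :: w) u -> d = word_digit w u.
Proof.
move=> /word_digitP[_ /cell_cons/andP[h1 h2]] /cell_cons/andP[h3 h4].
apply/eqP; rewrite eqn_leq; apply/andP; split;
  rewrite leqNgt; apply/negP => /lend_homo-/(_ w).
  by rewrite leNgt (le_lt_trans h3).
by rewrite leNgt (le_lt_trans h1).
Qed.

Lemma word_cell r u : cell [::] u -> word r u \in words r /\ cell (word r u) u.
Proof.
move=> u0; elim: r => // r [IH1 IH2].
have [h1 h2] := word_digitP IH2; split=> //; apply/allpairsP.
exists (word r u, word_digit (word r u) u); split=> //.
by rewrite mem_iota; move: h1; rewrite size_word.
Qed.

Lemma words_consP r w : w \in words r.+1 ->
  exists d w', [/\ w = d :: w', w' \in words r & (d < (k r).+1)%N].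
Proof.
by case/allpairsP=> -[w' d] [h1]; rewrite mem_iota => h2 ->; exists d, w'.
Qed.

Lemma cell_root r w : w \in words r -> cell w `<=` cell [::] /\ size w = r.
Proof.
elim: r w => [|r IH] w; first by rewrite inE => /eqP ->; split.
move=> /words_consP[d [w' [-> h1 h2]]]; have [h3 h4] := IH _ h1.
split; last by rewrite /= h4.
by apply: subset_trans h3; apply: cell_child; rewrite h4.
Qed.

Lemma cell_word r w u : w \in words r -> cell w u -> w = word r u.
Proof.
elim: r w => [|r IH] w; first by rewrite inE => /eqP ->.
move=> /words_consP[d [w' [-> h1 h2]]] h.
have [_ h4] := cell_root h1.
have h5 : cell w' u by move: h; apply: cell_child; rewrite h4.
by rewrite /= -(IH _ h1 h5); congr (_ :: _); exact: word_digit_uniq.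
Qed.

Lemma words_uniq r : uniq (words r).
Proof.
elim: r => // r IH.
apply: (@allpairs_uniq _ _ _ (fun w d => d :: w)) => //; first exact: iota_uniq.
by move=> [x1 x2] [y1 y2] _ _ /= [-> ->].
Qed.

(** The cells of each generation partition the root cell, so any function of the word is a step
    function. This turns integrals into sums over words. *)
Lemma wordE (F : seq nat -> R) r u : cell [::] u ->
  F (word r u) = \sum_(w <- words r) F w * \1_(cell w) u.
Proof.
move=> u0; have [h1 h2] := word_cell r u0.
rewrite (bigD1_seq (word r u))//= ?words_uniq// indicE mem_set// mulr1.
rewrite big_seq_cond big1 ?addr0// => w /andP[hw /eqP nw].
rewrite indicE memNset ?mulr0// => h; apply: nw; exact: cell_word.
Qed.

Lemma measurable_cell w : measurable (cell w : set (measurableTypeR R)).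
Proof. exact: measurable_itv. Qed.

Lemma lebesgue_cell w : lebesgue_measure (cell w) = (mass w)%:E.
Proof.
rewrite /cell lebesgue_measure_itv /= lte_fin ltrDl.
have [m0|] := ltP 0 (mass w); first by rewrite -EFinB addrAC subrr add0r.
by move=> m0; congr (_%:E); apply/le_anti; rewrite mass_ge0.
Qed.

Lemma lebesgue_root_lty : (lebesgue_measure (cell [::]) < +oo)%E.
Proof. by rewrite lebesgue_cell ltry. Qed.

(** Lebesgue measure on the root cell has total mass [mass [::]], so [P] is finite but in general
    not a probability. *)
Let P : {finite_measure set (measurableTypeR R) -> \bar R} :=
  mfrestr (measurable_cell [::]) lebesgue_root_lty.

(** Zeros fill in outside the root cell, a [P]-null set, so that words are defined on the whole
    line, have the right length and keep their digits within bounds. *)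
Definition total_word r u := if u \in cell [::] then word r u else nseq r 0%N.

Lemma total_wordE (F : seq nat -> R) r u : F (total_word r u) =
  \sum_(w <- words r) F w * \1_(cell w) u + F (nseq r 0%N) * \1_(~` cell [::]) u.
Proof.
rewrite /total_word; case: ifPn => [|] hu.
  by rewrite (wordE F r (set_mem hu)) [\1_(~` _) u]indicE in_setC hu mulr0 addr0.
rewrite [\1_(~` _) u]indicE in_setC hu mulr1 big_seq big1 ?add0r// => w hw.
rewrite indicE memNset ?mulr0// => uw; move/negP: hu; apply; apply/mem_set.
exact: (cell_root hw).1.
Qed.

Let bmeas_term (F : seq nat -> R) w :
  bmeas (fun u : measurableTypeR R => F w * \1_(cell w) u).
Proof. by apply: bmeasZ; apply: bmeas_indic; exact: measurable_cell. Qed.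

Let bmeas_rest (c : R) :
  bmeas (fun u : measurableTypeR R => c * \1_(~` cell [::]) u).
Proof.
by apply: bmeasZ; apply: bmeas_indic; apply: measurableC; exact: measurable_cell.
Qed.

Lemma bmeas_total_word (F : seq nat -> R) r :
  bmeas (fun u : measurableTypeR R => F (total_word r u)).
Proof.
under eq_fun do rewrite total_wordE.
by apply: bmeasD => //; apply: bmeas_sum.
Qed.

Lemma Rintegral_total_word (F : seq nat -> R) r :
  \int[P]_u F (total_word r u) = \sum_(w <- words r) F w * mass w.
Proof.
have Pfin : (P setT < +oo)%E by rewrite -ge0_fin_numE// fin_num_measure.
under eq_Rintegral do rewrite total_wordE.
rewrite RintegralD//; [|exact/bmeas_integrable/bmeas_sum|exact/bmeas_integrable].
rewrite Rintegral_sum// RintegralZ; last first.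
  apply: bmeas_integrable => //; apply: bmeas_indic; apply: measurableC.
  exact: measurable_cell.
rewrite Rintegral_indic; last by apply: measurableC; exact: measurable_cell.
rewrite (_ : fine (P (~` cell [::])) = 0); last first.
  by rewrite /= /mfrestr /mrestr setICl measure0.
rewrite mulr0 addr0 big_seq [RHS]big_seq.
apply: eq_bigr => w hw; rewrite RintegralZ; last first.
  by apply: bmeas_integrable => //; apply: bmeas_indic; exact: measurable_cell.
rewrite Rintegral_indic; last exact: measurable_cell.
congr (_ * _); rewrite /= /mfrestr /mrestr setIidl ?lebesgue_cell//.
exact: (cell_root hw).1.
Qed.

(** Since the latest digit comes first, the position of a digit is the length of the tail behind
    it. *)
Fixpoint wprod (c : nat -> nat -> R) w : R :=
  if w is d :: w' then c (size w') d * wprod c w' else 1.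

Definition digit r u := head 0%N (total_word r.+1 u).

Lemma wprod_total_word c r u :
  wprod c (total_word r u) = \prod_(i < r) c i (digit i u).
Proof.
elim: r => [|r IH]; first by rewrite big_ord0 /total_word; case: ifP.
rewrite big_ord_recr /= -IH mulrC /digit /total_word.
by case: ifP => _ /=; rewrite ?size_word ?size_nseq.
Qed.

(** All that is kept of the interval construction: bounded measurable digits, and integrals of
    product functions computed from the masses. *)
Lemma digit_process :
  exists (P : {measure set (measurableTypeR R) -> \bar R})
         (dg : nat -> measurableTypeR R -> nat),
  [/\ (P setT < +oo)%E,
      forall r (c : nat -> R), bmeas (c \o dg r),
      forall r u, (dg r u <= k r)%N &
      forall r (c : nat -> nat -> R), \int[P]_u (\prod_(i < r) c i (dg i u)) =
        \sum_(w <- words r) wprod c w * mass w].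
Proof.
exists P, digit; split.
- by rewrite -ge0_fin_numE// fin_num_measure.
- by move=> r c; exact: (bmeas_total_word (fun w => c (head 0%N w)) r.+1).
- move=> r u; rewrite /digit /total_word; case: ifPn => // /set_mem u0.
  rewrite -ltnS -{2}(size_word r u).
  by apply: (word_digitP _).1; exact: (word_cell r u0).2.
- move=> r c; rewrite -Rintegral_total_word; apply: eq_Rintegral => u _.
  by rewrite wprod_total_word.
Qed.

End Digits.

(** * Positive functionals and sums of squares *)

Section Bernstein.
Variable R : realType.

Definition bern (k d : nat) (y : R) : R := 'C(k, d)%:R * (y ^+ d * (1 - y) ^+ (k - d)).

Lemma sum_bern k y : \sum_(0 <= d < k.+1) bern k d y = 1.
Proof.
have := exprDn (1 - y) y k; rewrite subrK expr1n big_mkord => ->.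
by apply: eq_bigr => d _; rewrite /bern mulr_natl [y ^+ _ * _]mulrC.
Qed.

(** The mean of the binomial law, by the absorption identity
    [d.+1 * 'C(k.+1, d.+1) = k.+1 * 'C(k, d)]. *)
Lemma sum_bernM k y : \sum_(0 <= d < k.+1) d%:R * bern k d y = k%:R * y.
Proof.
case: k => [|k]; first by rewrite big_nat1 !mul0r.
rewrite big_nat_recl// mul0r add0r.
transitivity (\sum_(0 <= d < k.+1) k.+1%:R * y * bern k d y).
  apply: eq_bigr => d _; rewrite /bern mulrA -natrM -mul_bin_diag subSS exprS natrM.
  ring.
by rewrite -mulr_sumr sum_bern mulr1.
Qed.

(** The second moment: after the same absorption, one factor [d.+1] remains and splits into [d + 1],
    which leaves the mean and the total mass for one trial less. *)
Lemma sum_bernMM k y : \sum_(0 <= d < k.+1) (d%:R ^+ 2) * bern k d y =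
  k%:R ^+ 2 * y ^+ 2 + k%:R * (y - y ^+ 2).
Proof.
case: k => [|k]; first by rewrite big_nat1 /=; ring.
rewrite big_nat_recl// expr0n mul0r add0r.
transitivity (\sum_(0 <= d < k.+1) k.+1%:R * y * (d%:R * bern k d y + bern k d y)).
  apply: eq_bigr => d _; rewrite /bern.
  rewrite expr2 -mulrA [_ * ('C(_, _)%:R * _)]mulrA -natrM -mul_bin_diag subSS.
  rewrite exprS natrM -[d.+1]addn1 natrD.
  ring.
by rewrite -mulr_sumr big_split /= sum_bern sum_bernM -[k.+1]addn1 natrD; ring.
Qed.

End Bernstein.

(** * Sums of squares and binomial masses of words *)

Section PositiveFunctional.
Variables (R : realType) (T : pointedType).
Variables (A : set (T -> R)) (l : (T -> R) -> R).

Definition real_subalgebra :=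
  [/\ forall c, A (cst c), forall f g, A f -> A g -> A (f + g)
    & forall f g, A f -> A g -> A (f * g)].

Definition positive_functional :=
  [/\ forall f g, A f -> A g -> l (f + g) = l f + l g,
      forall c f, A f -> l (c *: f) = c * l f
    & forall f, A f -> 0 <= l (f ^+ 2)].

Inductive sos : (T -> R) -> Prop :=
| sos_sqr g of A g : sos (g ^+ 2)
| sosD f g of sos f & sos g : sos (f + g).

Hypothesis Aalg : real_subalgebra.
Hypothesis lpos : positive_functional.

Lemma A_cst c : A (cst c). Proof. by case: Aalg. Qed.
Lemma A_add f g : A f -> A g -> A (f + g). Proof. by case: Aalg => _ + _; apply. Qed.
Lemma A_mul f g : A f -> A g -> A (f * g). Proof. by case: Aalg => _ _; apply. Qed.

Lemma A_scale c f : A f -> A (c *: f).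
Proof.
move=> /(A_mul (A_cst c)); by congr A; apply/funext.
Qed.

Lemma A_opp f : A f -> A (- f).
Proof. by rewrite -scaleN1r; exact: A_scale. Qed.

Lemma A_sub f g : A f -> A g -> A (f - g).
Proof. by move=> hf /A_opp; exact: A_add. Qed.

Lemma A_exp f n : A f -> A (f ^+ n).
Proof.
move=> hf; elim: n => [|n IH]; first exact: A_cst.
by rewrite exprS; exact: A_mul.
Qed.

Lemma A_sum (I : Type) (s : seq I) (h : I -> T -> R) :
  (forall i, A (h i)) -> A (\sum_(i <- s) h i).
Proof. by move=> hh; apply: big_ind => //; [exact: A_cst | exact: A_add]. Qed.

Lemma A_prod (I : Type) (s : seq I) (h : I -> T -> R) :
  (forall i, A (h i)) -> A (\prod_(i <- s) h i).
Proof. by move=> hh; apply: big_ind => //; [exact: A_cst | exact: A_mul]. Qed.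

Lemma lD f g : A f -> A g -> l (f + g) = l f + l g.
Proof. by case: lpos => + _ _; apply. Qed.

Lemma lZ c f : A f -> l (c *: f) = c * l f.
Proof. by case: lpos => _ + _; apply. Qed.

Lemma l0 : l 0 = 0.
Proof. by rewrite -(scale0r (cst 0 : T -> R)) lZ ?mul0r//; exact: A_cst. Qed.

Lemma lB f g : A f -> A g -> l (f - g) = l f - l g.
Proof. by move=> hf hg; rewrite -[- g]scaleN1r lD ?lZ ?mulN1r//; exact: A_scale. Qed.

Lemma l_sum (I : Type) (s : seq I) (h : I -> T -> R) :
  (forall i, A (h i)) -> l (\sum_(i <- s) h i) = \sum_(i <- s) l (h i).
Proof.
move=> hh; elim: s => [|i s IH]; first by rewrite !big_nil l0.
by rewrite !big_cons lD ?IH//; exact: A_sum.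
Qed.

Lemma sos_A f : sos f -> A f.
Proof. by elim=> *; [exact: A_exp | exact: A_add]. Qed.

Lemma sos_ge0 f : sos f -> 0 <= l f.
Proof.
elim=> [g Ag|g h sg IHg sh IHh]; first by case: lpos => _ _; apply.
by rewrite lD ?addr_ge0//; exact: sos_A.
Qed.

(** By distributivity, since the product of two squares is the square of the product. *)
Lemma sosM f g : sos f -> sos g -> sos (f * g).
Proof.
move=> sf sg; elim: sf => [f' Af|f1 f2 _ IH1 _ IH2]; last first.
  by rewrite mulrDl; exact: sosD.
elim: sg => [g' Ag|g1 g2 _ IH1 _ IH2]; last by rewrite mulrDr; exact: sosD.
by rewrite -exprMn; apply: sos_sqr; exact: A_mul.
Qed.

Lemma sos_cst (c : R) : 0 <= c -> sos (cst c).
Proof.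
move=> c0; rewrite -(sqr_sqrtr c0).
by have := sos_sqr (A_cst (Num.sqrt c)); congr sos; apply/funext => t; rewrite !fctE.
Qed.

Lemma sosZ (c : R) f : 0 <= c -> sos f -> sos (c *: f).
Proof.
by move=> c0 sf; have := sosM (sos_cst c0) sf; congr sos.
Qed.

Lemma sosX f n : sos f -> sos (f ^+ n).
Proof.
move=> sf; elim: n => [|n IH]; first exact: sos_cst.
by rewrite exprS; exact: sosM.
Qed.

Lemma l_CauchySchwarz f g : A f -> A g -> l (f * g) ^+ 2 <= l (f ^+ 2) * l (g ^+ 2).
Proof.
move=> Af Ag.
have key (x : R) : 0 <= l (f ^+ 2) + 2 * x * l (f * g) + x ^+ 2 * l (g ^+ 2).
  have : 0 <= l ((f + x *: g) ^+ 2).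
    by apply: sos_ge0; apply: sos_sqr; apply: A_add => //; exact: A_scale.
  have -> : (f + x *: g) ^+ 2 = f ^+ 2 + ((2 * x) *: (f * g) + x ^+ 2 *: g ^+ 2).
    by apply/funext => t; rewrite !fctE /GRing.scale /=; ring.
  by rewrite !lD ?lZ ?addrA//; repeat first [exact: A_exp | exact: A_mul |
    apply: A_scale | apply: A_add].
have g0 : 0 <= l (g ^+ 2) by apply: sos_ge0; exact: sos_sqr.
have [g2|g2] := eqVneq (l (g ^+ 2)) 0.
  rewrite g2 mulr0; have [->|h] := eqVneq (l (f * g)) 0; first by rewrite expr0n.
  (* With [l (g ^+ 2) = 0] the quadratic is affine in [x]; a nonzero slope would let it take the
     value -1 at this [x]. *)
  have := key (- (l (f ^+ 2) + 1) / (2 * l (f * g))).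
  rewrite g2 mulr0 addr0 => k1; exfalso; move: k1.
  have -> : 2 * (- (l (f ^+ 2) + 1) / (2 * l (f * g))) * l (f * g) = - (l (f ^+ 2) + 1).
    by field.
  lra.
(* This [x] minimizes the quadratic. *)
have := key (- l (f * g) / l (g ^+ 2)).
have -> : l (f ^+ 2) + 2 * (- l (f * g) / l (g ^+ 2)) * l (f * g) +
   (- l (f * g) / l (g ^+ 2)) ^+ 2 * l (g ^+ 2) =
   (l (f ^+ 2) * l (g ^+ 2) - l (f * g) ^+ 2) / l (g ^+ 2) by field.
by rewrite pmulr_lge0 ?subr_ge0// invr_gt0 lt_def g2.
Qed.

Variables (N : nat) (Y : 'I_N.+1 -> T -> R).
Hypothesis Y_sos : forall i, sos (Y i).
Hypothesis Y1_sos : forall i, sos (1 - Y i).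

(** Digit [r] counts successes for the variable [Y (col r)]; the cyclic assignment serves every
    variable infinitely often. *)
Definition col r : 'I_N.+1 := inord (r %% N.+1).
(** Geometric growth makes the variances of the frequencies decay like [4 ^- r], fast enough for
    almost sure convergence. *)
Definition ntrials r := (4 ^ r)%N.

Definition fbern (k d : nat) (y : T -> R) : T -> R :=
  'C(k, d)%:R *: (y ^+ d * (1 - y) ^+ (k - d)).

Lemma fbernE k d y t : fbern k d y t = bern k d (y t).
Proof. by rewrite /fbern !fctE. Qed.

(** The probability of a word when its digits are independent and binomial with success
    probabilities [Y (col i)], kept as a function on [T]. *)
Fixpoint bprod (w : seq nat) : T -> R :=
  if w is d :: w' then
    fbern (ntrials (size w')) d (Y (col (size w'))) * bprod w'
  else 1.

(** Closure of sums of squares under products is what makes positivity of [l] on squares enough for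
    nonnegative masses. *)
Lemma sos_bprod w : sos (bprod w).
Proof.
elim: w => [|d w IH] /=; first exact: sos_cst.
by apply: sosM => //; apply: sosZ => //; apply: sosM; exact: sosX.
Qed.

Definition mass w := l (bprod w).

Lemma mass_ge0 w : 0 <= mass w.
Proof. by apply: sos_ge0; exact: sos_bprod. Qed.

Definition fbern_sum (k : nat) (c : nat -> R) (y : T -> R) : T -> R :=
  \sum_(0 <= d < k.+1) c d *: fbern k d y.

Lemma fbern_sum1 k y : fbern_sum k (fun=> 1) y = 1.
Proof.
apply/funext => t; rewrite /fbern_sum fct_sumE -[RHS](sum_bern k (y t)).
by apply: eq_bigr => d _; rewrite scale1r fbernE.
Qed.

(** Bernstein polynomials of a fixed degree sum to 1, so summing over the latest digit removes its
    factor. *)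
Lemma mass_children w :
  mass w = \sum_(0 <= d < (ntrials (size w)).+1) mass (d :: w).
Proof.
rewrite /mass -l_sum; last by move=> d; apply: sos_A; exact: sos_bprod.
rewrite /= -mulr_suml.
have := fbern_sum1 (ntrials (size w)) (Y (col (size w))).
rewrite /fbern_sum; under eq_bigr do rewrite scale1r.
by move=> ->; rewrite mul1r.
Qed.

Lemma size_words r w : w \in words ntrials r -> size w = r.
Proof.
elim: r w => [|r IH] w; first by rewrite inE => /eqP ->.
by move=> /words_consP[d [w' [-> h1 _]]] /=; rewrite (IH _ h1).
Qed.

(** Distributivity: given [Y], the digits are independent, so a product of functions of single
    digits has a product as conditional expectation. *)
Lemma sum_words_bprod r (c : nat -> nat -> R) :
  \sum_(w <- words ntrials r) wprod c w *: bprod w =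
  \prod_(i < r) fbern_sum (ntrials i) (c i) (Y (col i)).
Proof.
elim: r => [|r IH]; first by rewrite big_ord0 big_seq1 scale1r.
rewrite big_ord_recr -IH [RHS]/= mulr_suml.
rewrite -[words _ _.+1]/[seq d :: w | w <- words ntrials r, d <- iota 0 (ntrials r).+1].
rewrite big_allpairs_dep.
rewrite big_seq [RHS]big_seq; apply: eq_bigr => w /size_words hw.
rewrite /fbern_sum mulr_sumr; apply: eq_bigr => d _ /=.
by rewrite hw; apply/funext => t; rewrite !fctE /GRing.scale /=; ring.
Qed.

Lemma fbern_sum_frac k y : (0 < k)%N ->
  fbern_sum k (fun d => d%:R / k%:R) y = y.
Proof.
move=> k0; have k1 : k%:R != 0 :> R by rewrite pnatr_eq0 -lt0n.
apply/funext => t; rewrite /fbern_sum fct_sumE.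
transitivity (k%:R^-1 * \sum_(0 <= d < k.+1) d%:R * bern k d (y t)).
  rewrite mulr_sumr; apply: eq_bigr => d _.
  by rewrite -fbernE fctE /GRing.scale /=; ring.
by rewrite sum_bernM mulKf.
Qed.

(** The extra term is the variance [y (1 - y) / k] of a binomial frequency. *)
Lemma fbern_sum_frac2 k y : (0 < k)%N ->
  fbern_sum k (fun d => (d%:R / k%:R) ^+ 2) y =
  y ^+ 2 + k%:R^-1 *: (y - y ^+ 2).
Proof.
move=> k0; have k1 : k%:R != 0 :> R by rewrite pnatr_eq0 -lt0n.
apply/funext => t; rewrite /fbern_sum fct_sumE.
transitivity (k%:R^-1 ^+ 2 * \sum_(0 <= d < k.+1) d%:R ^+ 2 * bern k d (y t)).
  rewrite mulr_sumr; apply: eq_bigr => d _.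
  by rewrite -fbernE fctE /GRing.scale /=; ring.
by rewrite sum_bernMM !fctE /GRing.scale /=; field.
Qed.

(* Given Y, the digits behave as independent binomial variables; hence the
   product formula over distinct indices and the variance term below. *)
Lemma exchangeable_process :
  exists (P : {measure set (measurableTypeR R) -> \bar R})
         (a : nat -> measurableTypeR R -> R),
  [/\ (P setT < +oo)%E,
      forall r, bmeas (a r),
      forall r u, 0 <= a r u <= 1,
      forall s, uniq s ->
        \int[P]_u (\prod_(i <- s) a i u) = l (\prod_(i <- s) Y (col i)) &
      forall i, \int[P]_u (a i u ^+ 2) =
        l (Y (col i) ^+ 2 + (4 ^- i) *: (Y (col i) - Y (col i) ^+ 2))].
Proof.
have [P [dg [Pfin mdg dg_le Pdg]]] := digit_process mass_ge0 mass_children.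
have nt0 r : (0 < ntrials r)%N by rewrite expn_gt0.
have Pprod r (c : nat -> nat -> R) : \int[P]_u (\prod_(i < r) c i (dg i u)) =
    l (\prod_(i < r) fbern_sum (ntrials i) (c i) (Y (col i))).
  rewrite Pdg -sum_words_bprod l_sum; last first.
    by move=> w; apply: A_scale; apply: sos_A; exact: sos_bprod.
  by apply: eq_bigr => w _; rewrite lZ//; apply: sos_A; exact: sos_bprod.
exists P, (fun r u => (dg r u)%:R / (ntrials r)%:R); split=> //.
- by move=> r; exact: (mdg r (fun d => d%:R / (ntrials r)%:R)).
- move=> r u; rewrite divr_ge0//= ler_pdivrMr ?mul1r ?ler_nat ?dg_le//.
  by rewrite ltr0n.
(* [b] exceeds every index in [s]; the digits below [b] outside [s] receive the constant factor 1,
   whose Bernstein sum is 1. *)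
- move=> s us; pose b := (\max_(i <- s) i).+1.
  have sb i : i \in s -> (i < b)%N by move=> h; rewrite ltnS leq_bigmax_seq.
  have E (S : comPzRingType) (F : nat -> S) :
      \prod_(i <- s) F i = \prod_(i < b) (if (i : nat) \in s then F i else 1).
    rewrite -big_mkcond /= -(big_mkord (fun i => i \in s) F) -[RHS]big_filter.
    apply: perm_big; apply: uniq_perm => //; first exact/filter_uniq/iota_uniq.
    move=> i; rewrite mem_filter mem_index_iota /=.
    by case h: (i \in s) => //=; rewrite sb.
  under eq_Rintegral do rewrite E.
  pose c i d : R := if i \in s then d%:R / (ntrials i)%:R else 1.
  transitivity (\int[P]_u (\prod_(i < b) c i (dg i u))).
    by apply: eq_Rintegral => u _; apply: eq_bigr => i _; rewrite /c; case: ifP.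
  rewrite Pprod E; congr l; apply: eq_bigr => i _; rewrite /c.
  by case: ifP => _; [exact: fbern_sum_frac | exact: fbern_sum1].
- move=> i.
  pose c j d : R := if j == i then (d%:R / (ntrials i)%:R) ^+ 2 else 1.
  transitivity (\int[P]_u (\prod_(j < i.+1) c j (dg j u))).
    apply: eq_Rintegral => u _; rewrite big_ord_recr /= /c eqxx big1 ?mul1r//.
    by move=> j _; rewrite ltn_eqF.
  rewrite Pprod big_ord_recr /= big1 => [|j _]; last first.
    by rewrite -[RHS](fbern_sum1 (ntrials j) (Y (col j))) /c ltn_eqF.
  by rewrite mul1r /c eqxx fbern_sum_frac2// natrX.
Qed.

End PositiveFunctional.

(** * Almost sure limits and moments *)

Section AlmostSureLimits.
Context d (T : measurableType d) (R : realType).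
Variable P : {measure set T -> \bar R}.
Hypothesis Pfin : (P setT < +oo)%E.
Variable a : nat -> T -> R.
Hypothesis a_bmeas : forall j, bmeas (a j).

Let step j x := `|a j.+1 x - a j x|.

Let step_bmeas j : bmeas (step j).
Proof.
have [mb [M hM]] := bmeasB (a_bmeas j.+1) (a_bmeas j).
split; first by apply: measurableT_comp => //; exact: normr_measurable.
by exists M => x; rewrite normr_id.
Qed.

(** The integrals of the steps are summable, so the total variation is integrable, hence almost
    everywhere finite, and the telescoping series converges absolutely. *)
Lemma ae_cvgn_summable_steps (C : R) :
  (forall j, \int[P]_x step j x <= C * 2^-1 ^+ j) ->
  {ae P, forall x, cvgn (a ^~ x)}.
Proof.
move=> hstep.
have mstep j : measurable_fun setT (fun x => (step j x)%:E).
  by apply/measurable_EFinP; exact: (step_bmeas j).1.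
have C0 : 0 <= C.
  have := hstep 0%N; rewrite expr0 mulr1; apply: le_trans.
  by apply: Rintegral_ge0 => x _; exact: normr_ge0.
have sum_lty : (\int[P]_x (\sum_(0 <= j <oo) (step j x)%:E) < +oo)%E.
  rewrite integral_nneseries//; last by move=> j x _; rewrite lee_fin normr_ge0.
  apply: (@le_lt_trans _ _ (C * 2)%:E); last exact: ltry.
  apply: lime_le.
    apply: is_cvg_nneseries => j _ _; apply: integral_ge0 => x _.
    by rewrite lee_fin normr_ge0.
  apply: nearW => k.
  have -> : (\sum_(0 <= j < k) \int[P]_x (step j x)%:E =
      (\sum_(0 <= j < k) \int[P]_x step j x)%:E)%E.
    rewrite -sumEFin; apply: eq_bigr => j _; rewrite /Rintegral fineK//.
    by apply: integrable_fin_num => //; exact: (bmeas_integrable Pfin (step_bmeas j)).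
  rewrite lee_fin (le_trans (ler_sum _ (fun j _ => hstep j)))//.
  rewrite -mulr_sumr ler_wpM2l//.
  have -> : \sum_(0 <= j < k) 2^-1 ^+ j = 2 - 2 * 2^-1 ^+ k :> R.
    elim: k => [|k IH]; first by rewrite big_geq// expr0; lra.
    by rewrite big_nat_recr//= IH exprS; field.
  by rewrite gerDl oppr_le0 mulr_ge0// exprn_ge0.
have int_sum : P.-integrable setT (fun x => \sum_(0 <= j <oo) (step j x)%:E)%E.
  apply/integrableP; split.
    by apply: ge0_emeasurable_sum => [j x _ _|j _]//; rewrite lee_fin normr_ge0.
  rewrite (eq_integral (fun x => \sum_(0 <= j <oo) (step j x)%:E)%E)// => x _.
  by rewrite gee0_abs// nneseries_ge0// => j _ _; rewrite lee_fin normr_ge0.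
have := integrable_ae measurableT int_sum; apply: filterS => x /(_ I) hx.
have tel : series (telescope (a ^~ x)) = (fun j => a j x - a 0%N x).
  by apply/funext => j; rewrite [a j x](eq_sum_telescope (a ^~ x)) addrC addKr.
have : cvgn (series (telescope (a ^~ x))).
  apply: normed_cvg; apply: nondecreasing_is_cvgn.
    by apply: nondecreasing_series => j _ _; exact: normr_ge0.
  exists (fine (\sum_(0 <= j <oo) (step j x)%:E)%E) => _ [k _ <-].
  rewrite -lee_fin fineK// /series /= -sumEFin.
  by apply: nneseries_lim_ge => j _ _; rewrite lee_fin normr_ge0.
rewrite tel => h.
have -> : a ^~ x = (fun j => (a j x - a 0%N x) + a 0%N x).
  by apply/funext => j; rewrite subrK.
by apply: is_cvgD => //; exact: is_cvg_cst.
Qed.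

(** With [h = 2 ^- j], the inequality [2 |y| <= y ^+ 2 / h + h] turns the bound on squares into a
    summable bound of order [h] on the steps. *)
Lemma ae_cvgn_L2_steps (C : R) :
  (forall j, \int[P]_x ((a j.+1 x - a j x) ^+ 2) <= C * 4 ^- j) ->
  {ae P, forall x, cvgn (a ^~ x)}.
Proof.
move=> hC; apply: (@ae_cvgn_summable_steps (2^-1 * (C + fine (P setT)))) => j.
pose h := 2^-1 ^+ j : R.
have h0 : 0 < h by rewrite exprn_gt0.
have hh : 4 ^- j = h * h :> R.
  by rewrite /h -exprMn -exprVn; congr (_ ^+ _); field.
have bsq : bmeas (fun x => (a j.+1 x - a j x) ^+ 2).
  by apply: bmeasX; apply: bmeasB.
pose g x := 2^-1 * (h^-1 * (a j.+1 x - a j x) ^+ 2 + h).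
apply: (@le_trans _ _ (\int[P]_x g x)).
  apply: le_Rintegral => //; try exact: bmeas_integrable.
    by apply: bmeas_integrable => //; do 2?apply: bmeasZ; apply: bmeasD;
      [exact: bmeasZ | exact: bmeas_cst].
  (* AM-GM *)
  move=> x _; rewrite /g /step -(real_normK (num_real (_ - _))).
  set y := `|_|; rewrite -subr_ge0.
  have -> : 2^-1 * (h^-1 * y ^+ 2 + h) - y = 2^-1 * h^-1 * (y - h) ^+ 2.
    by field; rewrite gt_eqF.
  by rewrite mulr_ge0 ?sqr_ge0// mulr_ge0// invr_ge0 ltW.
rewrite /g RintegralZ; last first.
  by apply: bmeas_integrable => //; apply: bmeasD; [exact: bmeasZ | exact: bmeas_cst].
rewrite -mulrA ler_pM2l// RintegralD//; try (apply: bmeas_integrable => //;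
  first [exact: bmeasZ | exact: bmeas_cst]).
rewrite RintegralZ; last exact: bmeas_integrable.
rewrite Rintegral_cst// mulrDl -/h [fine _ * h]mulrC lerD2r.
by rewrite ler_pdivrMl// mulrC -mulrA -hh.
Qed.

End AlmostSureLimits.

(** * Random variables with the moments prescribed by [l] *)

Section MomentProcess.
Variables (R : realType) (T : pointedType) (A : set (T -> R)) (l : (T -> R) -> R).
Hypotheses (Aalg : real_subalgebra A) (lpos : positive_functional A l).
Variables (N : nat) (Y : 'I_N.+1 -> T -> R).
Hypotheses (Y_sos : forall i, sos A (Y i)) (Y1_sos : forall i, sos A (1 - Y i)).

Lemma cvg_prod_seq (I : Type) (s : seq I) (f : I -> nat -> R) (g : I -> R) :
  (forall i, f i @ \oo --> g i) ->
  (fun j => \prod_(i <- s) f i j) @ \oo --> \prod_(i <- s) g i.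
Proof.
move=> fg; elim: s => [|i s IH].
  under eq_fun do rewrite big_nil.
  by rewrite big_nil; exact: cvg_cst.
under eq_fun do rewrite big_cons.
by rewrite big_cons; exact: cvgM.
Qed.

(** [X i] is the almost sure limit of the frequencies of the digits assigned to [i]. The product
    formula over distinct indices passes to the limit and gives all moments, those with repeated
    factors included. *)
Theorem moment_process :
  exists (P : {measure set (measurableTypeR R) -> \bar R})
         (X : 'I_N.+1 -> measurableTypeR R -> R),
  [/\ (P setT < +oo)%E,
      forall i, bmeas (X i),
      forall i u, 0 <= X i u <= 1 &
      forall L : seq 'I_N.+1,
        \int[P]_u (\prod_(i <- L) X i u) = l (\prod_(i <- L) Y i)].
Proof.
have [P [a [Pfin ba a01 aprod asq]]] := exchangeable_process Aalg lpos Y_sos Y1_sos.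
(* The successive indices assigned to the variable [i]; distinct pairs give distinct indices. *)
pose idx (i : 'I_N.+1) j := (j * N.+1 + i)%N.
have colidx i j : col N (idx i j) = i.
  by rewrite /col /idx modnMDl modn_small// inord_val.
have Adiff i j : \int[P]_u ((a (idx i j.+1) u - a (idx i j) u) ^+ 2) <=
    2 * l (Y i - Y i ^+ 2) * 4 ^- j.
  rewrite Rintegral_sqrB//.
  (* The indices being distinct, the cross term is exactly [l (Y i ^+ 2)]. It cancels the main parts
     of the two squares, and only the variance terms remain. *)
  have -> : \int[P]_u (a (idx i j.+1) u * a (idx i j) u) = l (Y i ^+ 2).
    have := aprod [:: idx i j.+1; idx i j].
    rewrite !big_cons !big_nil !colidx mulr1 -expr2 => <-; last first.
      by rewrite /= inE andbT /idx eqn_add2r eqn_mul2r /= gtn_eqF.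
    by apply: eq_Rintegral => u _; rewrite !big_cons big_nil mulr1.
  have AY : A (Y i) by exact: (sos_A Aalg).
  have AY2 : A (Y i ^+ 2) by exact: A_exp.
  have AYY : A (Y i - Y i ^+ 2) by exact: A_sub.
  have l0 : 0 <= l (Y i - Y i ^+ 2).
    apply: (sos_ge0 Aalg lpos); have := sosM Aalg (Y_sos i) (Y1_sos i).
    by rewrite mulrBr mulr1.
  rewrite !asq !colidx; move: (Y i - Y i ^+ 2) AYY l0 => Z AYY l0.
  rewrite !(lD lpos) ?(lZ lpos)//; try exact: A_scale.
  set m := l (Y i ^+ 2); set c := l Z in l0 *.
  have -> : m + 4 ^- idx i j.+1 * c + (m + 4 ^- idx i j * c) - 2 * m =
      (4 ^- idx i j.+1 + 4 ^- idx i j) * c by ring.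
  rewrite mulrAC ler_wpM2r// mulr_natl mulr2n.
  have le4 k : (j <= k)%N -> (4 ^- k <= 4 ^- j :> R).
    move=> jk; rewrite lef_pV2 ?posrE ?exprn_gt0//.
    by rewrite ler_weXn2l// ler1n.
  have jj : (j <= idx i j)%N by rewrite /idx (leq_trans _ (leq_addr _ _))// leq_pmulr.
  apply: lerD; apply: le4 => //.
  by rewrite (leq_trans jj)// /idx leq_add2r leq_mul2r leqnSn orbT.
(* The upper limit is measurable whether or not the frequencies converge, and the truncation gives
   the bounds 0 and 1 directly. *)
pose lim0 i u := limn_sup (fun j => a (idx i j) u).
pose X i u := Num.max 0 (Num.min 1 (lim0 i u)).
have hub i u : has_ubound (range (fun j => a (idx i j) u)).
  by exists 1 => _ [j _ <-]; case/andP: (a01 (idx i j) u).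
have hlb i u : has_lbound (range (fun j => a (idx i j) u)).
  by exists 0 => _ [j _ <-]; case/andP: (a01 (idx i j) u).
have X01 i u : 0 <= X i u <= 1.
  by rewrite /X le_max lexx /= ge_max ler01 ge_min lexx.
have bX i : bmeas (X i).
  split; last first.
    by exists 1 => u; case/andP: (X01 i u) => ? ?; rewrite ger0_norm.
  apply: measurable_maxr; first exact: measurable_cst.
  apply: measurable_minr; first exact: measurable_cst.
  apply: measurable_fun_limn_sup => [t _|t _|j]; [exact: hub|exact: hlb|].
  exact: (ba (idx i j)).1.
have acvg : {ae P, forall u, forall i, (fun j => a (idx i j) u) @ \oo --> X i u}.
  have key i : {ae P, forall u, (fun j => a (idx i j) u) @ \oo --> X i u}.
    have := ae_cvgn_L2_steps Pfin (fun j => ba (idx i j)) (Adiff i).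
    apply: filterS => u hu; suff -> : X i u = limn (fun j => a (idx i j) u) by [].
    have h0 : 0 <= limn (fun j => a (idx i j) u).
      by apply: limr_ge => //; apply: nearW => j; case/andP: (a01 (idx i j) u).
    have h1 : limn (fun j => a (idx i j) u) <= 1.
      by apply: limr_le => //; apply: nearW => j; case/andP: (a01 (idx i j) u).
    rewrite /X /lim0 cvg_limn_supE//.
    by rewrite (min_idPr h1) (max_idPr h0).
  (* The variables are reindexed by [nat] so that countably many almost sure events can be
     intersected. *)
  have : {ae P, forall u k, (fun j => a (idx (inord k) j) u) @ \oo --> X (inord k) u}.
    by apply: ae_foralln => k; exact: key.
  by apply: filterS => u h i; have := h i; rewrite inord_val.
exists P, X; split=> // L.
(* Repeated factors of the monomial get distinct indices, all tending to
   infinity with j, so that the moments are exact for every j. *)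
pose s j := [seq idx (nth ord0 L k) (j + k) | k <- iota 0 (size L)].
have us j : uniq (s j).
  (* Dividing an index by [N.+1] recovers [j + k]. *)
  rewrite map_inj_uniq ?iota_uniq// => k k' /(congr1 (divn^~ N.+1)).
  by rewrite /idx !divnMDl// !divn_small// !addn0 => /addnI.
have : (fun j => \int[P]_u (\prod_(i <- s j) a i u)) @ \oo -->
    \int[P]_u (\prod_(i <- L) X i u).
  have bs j : bmeas (fun u => \prod_(i <- s j) a i u) by exact: bmeas_prod.
  have bL : bmeas (fun u => \prod_(i <- L) X i u) by exact: bmeas_prod.
  apply: (@bounded_cvg_Rintegral _ _ _ P Pfin _ _ 1) => [j||j u|].
  - exact: (bs j).1.
  - exact: bL.1.
  - apply: (big_ind (fun y : R => `|y| <= 1)) => [|x y hx hy|i _].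
      by rewrite normr1.
      by rewrite normrM mulr_ile1.
    by case/andP: (a01 i u) => ? ?; rewrite ger0_norm.
  - move: acvg; apply: filterS => u hu.
    rewrite (big_nth ord0) /index_iota subn0.
    rewrite (_ : (fun j => _) =
      (fun j => \prod_(k <- iota 0 (size L)) a (idx (nth ord0 L k) (j + k)) u)).
      apply: cvg_prod_seq => k.
      by have := hu (nth ord0 L k); rewrite -(cvg_shiftn k).
    by apply/funext => j; rewrite big_map.
suff -> : (fun j => \int[P]_u (\prod_(i <- s j) a i u)) =
    (fun=> l (\prod_(i <- L) Y i)).
  by move=> /cvg_lim <-//; rewrite lim_cst.
apply/funext => j; rewrite aprod// big_map (big_nth ord0) /index_iota subn0.
by congr l; apply: eq_bigr => k _; rewrite colidx.
Qed.

End MomentProcess.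

(** * The algebra generated by the polynomials and theta *)

Section PolynomialFunctions.
Variables (R : realType) (N : nat).
Implicit Types q : ('I_N -> R) -> R.

(** Coefficients are paired with words in the variables, the form in which the moments of the
    process are known. *)
Definition polyf q := exists s : seq (R * seq 'I_N),
  forall x, q x = \sum_(m <- s) m.1 * \prod_(i <- m.2) x i.

Lemma polyf_cst c : polyf (fun=> c).
Proof. by exists [:: (c, [::])] => x; rewrite big_seq1 big_nil mulr1. Qed.

Lemma polyf_var i : polyf (fun x => x i).
Proof. by exists [:: (1, [:: i])] => x; rewrite !big_seq1 mul1r. Qed.

Lemma polyfD q r : polyf q -> polyf r -> polyf (fun x => q x + r x).
Proof. by move=> [s hs] [s' hs']; exists (s ++ s') => x; rewrite hs hs' big_cat. Qed.

Lemma polyfM q r : polyf q -> polyf r -> polyf (fun x => q x * r x).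
Proof.
move=> [s hs] [s' hs'].
exists [seq (m.1 * m'.1, m.2 ++ m'.2) | m <- s, m' <- s'] => x.
rewrite hs hs' big_allpairs_dep mulr_suml; apply: eq_bigr => m _.
by rewrite mulr_sumr; apply: eq_bigr => m' _ /=; rewrite big_cat /=; ring.
Qed.

Lemma polyfZ c q : polyf q -> polyf (fun x => c * q x).
Proof. by move=> hq; apply: polyfM => //; exact: polyf_cst. Qed.

Lemma polyfX q k : polyf q -> polyf (fun x => q x ^+ k).
Proof.
move=> hq; elim: k => [|k IH]; first exact: polyf_cst.
by under eq_fun do rewrite exprS; exact: polyfM.
Qed.

Lemma polyf_bounded q : polyf q ->
  exists M, forall x, (forall i, 0 <= x i <= 1) -> `|q x| <= M.
Proof.
move=> [s hs]; exists (\sum_(m <- s) `|m.1|) => x x01.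
rewrite hs (le_trans (ler_norm_sum _ _ _))//; apply: ler_sum => m _.
rewrite normrM ler_piMr//.
apply: (big_ind (fun y : R => `|y| <= 1)) => [|y z hy hz|i _].
- by rewrite normr1.
- by rewrite normrM mulr_ile1.
- by case/andP: (x01 i) => ? ?; rewrite ger0_norm.
Qed.

End PolynomialFunctions.

(** * Closure properties of algebras of complex functions *)

Section Subalgebras.
Variables (R : rcfType) (T : Type).
Implicit Types (S G : set (T -> R[i])).

Lemma subalgebra_cst S c : is_subalgebra S -> S (fun=> c).
Proof.
move=> [S1 SD _]; have S0 : S (fun=> 0).
  by have := SD (-1) _ _ S1 S1; congr S; apply/funext => t; rewrite mulr1 addNr.
by have := SD c _ _ S1 S0; congr S; apply/funext => t; rewrite mulr1 addr0.
Qed.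

Lemma subalgebraD S f g : is_subalgebra S -> S f -> S g -> S (fun t => f t + g t).
Proof.
move=> [_ SD _] hf hg; have := SD 1 _ _ hf hg; congr S.
by apply/funext => t; rewrite mul1r.
Qed.

Lemma subalgebraM S f g : is_subalgebra S -> S f -> S g -> S (fun t => f t * g t).
Proof. by move=> [_ _ SM]; exact: SM. Qed.

Lemma subalgebraX S f k : is_subalgebra S -> S f -> S (fun t => f t ^+ k).
Proof.
move=> hS hf; elim: k => [|k IH]; first exact: subalgebra_cst.
by under eq_fun do rewrite exprS; exact: subalgebraM.
Qed.

Lemma subalgebra_sum S (I : Type) (s : seq I) (F : I -> T -> R[i]) :
  is_subalgebra S -> (forall i, S (F i)) -> S (fun t => \sum_(i <- s) F i t).
Proof.
move=> hS hF; elim: s => [|i s IH].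
  by under eq_fun do rewrite big_nil; exact: subalgebra_cst.
by under eq_fun do rewrite big_cons; exact: subalgebraD.
Qed.

Lemma subalgebra_prod S (I : Type) (s : seq I) (F : I -> T -> R[i]) :
  is_subalgebra S -> (forall i, S (F i)) -> S (fun t => \prod_(i <- s) F i t).
Proof.
move=> hS hF; elim: s => [|i s IH].
  by under eq_fun do rewrite big_nil; exact: subalgebra_cst.
by under eq_fun do rewrite big_cons; exact: subalgebraM.
Qed.

Lemma generated_algebraP G : is_subalgebra (generated_algebra G).
Proof.
split=> [S [hS _]|a f g hf hg S [hS GS]|f g hf hg S [hS GS]].
- exact: subalgebra_cst.
- by case: (hS) => _ SD _; apply: SD; [apply: hf | apply: hg].
- by apply: subalgebraM => //; [apply: hf | apply: hg].
Qed.

Lemma sub_generated_algebra G : G `<=` generated_algebra G.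
Proof. by move=> f Gf S [_]; apply. Qed.

End Subalgebras.

(** * Bounded coordinates and the real algebra of polynomials and [theta] *)

Section ThetaAlgebra.
Variables (R : realType) (n m : nat) (p : m.-tuple (mpoly.mpoly n R)).
Local Notation V := 'rV[R]_n.

Definition denom (t : V) : R :=
  1 + \sum_(j < n) t ord0 j ^+ 2 + \sum_(k < m) real_mpoly_fun (tnth p k) t ^+ 2.

Lemma thetaE t : theta p t = (denom t)^-1. Proof. by []. Qed.

Lemma denom_ge1 t : 1 <= denom t.
Proof.
by rewrite /denom -addrA lerDl addr_ge0// sumr_ge0// => i _; exact: sqr_ge0.
Qed.

Lemma denom_gt0 t : 0 < denom t.
Proof. exact: lt_le_trans ltr01 (denom_ge1 t). Qed.

Lemma denom_neq0 t : denom t != 0. Proof. by rewrite gt_eqF// denom_gt0. Qed.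

Lemma theta_gt0 t : 0 < theta p t. Proof. by rewrite thetaE invr_gt0 denom_gt0. Qed.

Lemma theta_le1 t : theta p t <= 1.
Proof. by rewrite thetaE invf_le1 ?denom_gt0 ?denom_ge1. Qed.

(* [boxed] and [1 - boxed] are sums of squares because
   [1 + 2 theta t_j = theta (denom + 2 t_j)] and [1 + 2 t_j + t_j ^ 2] is a square. *)
Definition boxed (i : 'I_n.+1) (t : V) : R :=
  if unlift ord0 i is Some j then 2^-1 + theta p t * t ord0 j else theta p t.

(** Left inverse of [boxed]. Where [x ord0 = 0] the division returns the zero vector, a default
    value that the process almost surely avoids. *)
Definition unboxed (x : 'I_n.+1 -> R) : V :=
  \row_j ((x (lift ord0 j) - 2^-1) / x ord0).

Lemma boxed0 t : boxed ord0 t = theta p t.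
Proof. by rewrite /boxed unlift_none. Qed.

Lemma boxedS j t : boxed (lift ord0 j) t = 2^-1 + theta p t * t ord0 j.
Proof. by rewrite /boxed liftK. Qed.

Lemma boxedK t : unboxed (boxed ^~ t) = t.
Proof.
apply/rowP => j; rewrite mxE boxed0 boxedS addrC addKr mulrC mulKf//.
by rewrite gt_eqF// theta_gt0.
Qed.

(** Clearing denominators: in the coordinates [x], the function becomes polynomial after
    multiplication by a power of [x ord0]. This places polynomials in [theta_funs] and, applied to
    [denom], controls the process off the image of [boxed]. *)
Definition homogenizable (h : V -> R) := exists K q, polyf q /\
  forall x, x ord0 != 0 -> x ord0 ^+ K * h (unboxed x) = q x.

Lemma homogenizable_cst c : homogenizable (fun=> c).
Proof. by exists 0%N, (fun=> c); split=> [|x _]; [exact: polyf_cst|rewrite mul1r]. Qed.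

Lemma homogenizable_coord j : homogenizable (fun t => t ord0 j).
Proof.
exists 1%N, (fun x => x (lift ord0 j) + - 2^-1); split=> [|x x0].
  by apply: polyfD; [exact: polyf_var | exact: polyf_cst].
by rewrite mxE expr1 mulrC divfK.
Qed.

Lemma homogenizableD f g : homogenizable f -> homogenizable g ->
  homogenizable (fun t => f t + g t).
Proof.
move=> [K [q [hq fq]]] [K' [q' [hq' gq']]].
exists (K + K')%N, (fun x => x ord0 ^+ K' * q x + x ord0 ^+ K * q' x).
split=> [|x x0].
  by apply: polyfD; apply: polyfM => //; apply: polyfX; exact: polyf_var.
by rewrite -fq// -gq'// exprD; ring.
Qed.

Lemma homogenizableM f g : homogenizable f -> homogenizable g ->
  homogenizable (fun t => f t * g t).
Proof.
move=> [K [q [hq fq]]] [K' [q' [hq' gq']]].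
exists (K + K')%N, (fun x => q x * q' x); split=> [|x x0]; first exact: polyfM.
by rewrite -fq// -gq'// exprD; ring.
Qed.

Lemma homogenizableX f k : homogenizable f -> homogenizable (fun t => f t ^+ k).
Proof.
move=> hf; elim: k => [|k IH]; first exact: homogenizable_cst.
by under eq_fun do rewrite exprS; exact: homogenizableM.
Qed.

Lemma homogenizable_sum (I : Type) (s : seq I) (h : I -> V -> R) :
  (forall i, homogenizable (h i)) -> homogenizable (fun t => \sum_(i <- s) h i t).
Proof.
move=> hh; elim: s => [|i s IH].
  by under eq_fun do rewrite big_nil; exact: homogenizable_cst.
by under eq_fun do rewrite big_cons; exact: homogenizableD.
Qed.

Lemma homogenizable_prod (I : Type) (s : seq I) (h : I -> V -> R) :
  (forall i, homogenizable (h i)) -> homogenizable (fun t => \prod_(i <- s) h i t).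
Proof.
move=> hh; elim: s => [|i s IH].
  by under eq_fun do rewrite big_nil; exact: homogenizable_cst.
by under eq_fun do rewrite big_cons; exact: homogenizableM.
Qed.

Lemma homogenizable_mpoly q : homogenizable (real_mpoly_fun q).
Proof.
rewrite /real_mpoly_fun; under eq_fun do rewrite mpoly.mevalE.
apply: homogenizable_sum => w; apply: homogenizableM; first exact: homogenizable_cst.
by apply: homogenizable_prod => i; apply: homogenizableX; exact: homogenizable_coord.
Qed.

Lemma homogenizable_denom : homogenizable denom.
Proof.
apply: homogenizableD; last first.
  by apply: homogenizable_sum => k; apply: homogenizableX; exact: homogenizable_mpoly.
apply: homogenizableD; first exact: homogenizable_cst.
by apply: homogenizable_sum => k; apply: homogenizableX; exact: homogenizable_coord.
Qed.

(** A filtration by growth: the functions of level 0 are bounded, and each further level allows one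
    more factor [denom]. *)
Definition theta_fun (K : nat) : set (V -> R) :=
  [set f | exists2 q, polyf q & forall t, f t = denom t ^+ K * q (boxed ^~ t)].

Definition theta_funs : set (V -> R) := [set f | exists K, theta_fun K f].

Lemma theta_funS K f : theta_fun K.+1 f ->
  theta_fun K (fun t => theta p t * f t).
Proof.
move=> [q hq fq]; exists q => // t.
by rewrite fq thetaE exprS -mulrA mulKf// denom_neq0.
Qed.

(** The factor [x ord0] evaluates to [theta], which cancels the additional [denom]. *)
Lemma theta_fun_raise K f : theta_fun K f -> theta_fun K.+1 f.
Proof.
move=> [q hq fq]; exists (fun x => x ord0 * q x) => [|t].
  by apply: polyfM => //; exact: polyf_var.
by rewrite boxed0 fq thetaE exprS; field; exact: denom_neq0.
Qed.

Lemma theta_fun_le K K' f : (K <= K')%N -> theta_fun K f -> theta_fun K' f.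
Proof.
move=> /subnKC <-; elim: (K' - K)%N => [|k IH]; first by rewrite addn0.
by rewrite addnS => /IH/theta_fun_raise.
Qed.

Lemma theta_fun_poly K q : polyf q -> theta_fun K (fun t => q (boxed ^~ t)).
Proof. by move=> hq; apply: (@theta_fun_le 0) => //; exists q => // t; rewrite mul1r. Qed.

Lemma theta_funD K f g : theta_fun K f -> theta_fun K g -> theta_fun K (f + g).
Proof.
move=> [q hq fq] [r hr gr]; exists (fun x => q x + r x) => [|t]; first exact: polyfD.
by rewrite !fctE fq gr mulrDr.
Qed.

Lemma theta_funM K K' f g : theta_fun K f -> theta_fun K' g -> theta_fun (K + K') (f * g).
Proof.
move=> [q hq fq] [r hr gr]; exists (fun x => q x * r x) => [|t]; first exact: polyfM.
by rewrite !fctE fq gr exprD; ring.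
Qed.

Lemma theta_funs_alg : real_subalgebra theta_funs.
Proof.
split=> [c|f g [K hf] [K' hg]|f g [K hf] [K' hg]].
- by exists 0%N; apply: (@theta_fun_poly 0 (fun=> c)); exact: polyf_cst.
- exists (K + K')%N; apply: theta_funD; first by apply: theta_fun_le hf; rewrite leq_addr.
  by apply: theta_fun_le hg; rewrite leq_addl.
- by exists (K + K')%N; exact: theta_funM.
Qed.

(** At [x = boxed t] the factor [x ord0 ^+ K] is [theta ^+ K], whose inverse is [denom ^+ K]. *)
Lemma homogenizable_theta_funs h : homogenizable h -> theta_funs h.
Proof.
move=> [K [q [hq qh]]]; exists K, q => // t; rewrite -qh boxed0 ?boxedK; last first.
  by rewrite gt_eqF// theta_gt0.
by rewrite thetaE mulrA -exprMn divff ?expr1n ?mul1r// denom_neq0.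
Qed.

Lemma theta_funs_poly q : polyf q -> theta_funs (fun t => q (boxed ^~ t)).
Proof. by move=> hq; exists 0%N; exact: theta_fun_poly. Qed.

Lemma theta_funs_theta : theta_funs (theta p).
Proof.
have := theta_funs_poly (polyf_var R (ord0 : 'I_n.+1)).
by congr theta_funs; apply/funext => t; rewrite boxed0.
Qed.

Lemma theta_funs_denom : theta_funs denom.
Proof. exact: homogenizable_theta_funs homogenizable_denom. Qed.

Lemma theta_funs_boxed i : theta_funs (boxed i).
Proof. exact: (theta_funs_poly (polyf_var R i)). Qed.

Lemma theta_funs_mpoly q : theta_funs (real_mpoly_fun q).
Proof. exact: homogenizable_theta_funs (homogenizable_mpoly q). Qed.

Let sos_sqrs (I : finType) (Q : pred I) (h : I -> V -> R) :
  (forall i, theta_funs (h i)) -> sos theta_funs (\sum_(i | Q i) h i ^+ 2).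
Proof.
move=> hh; apply: big_ind => [|f g|i _]; first exact: (sos_cst theta_funs_alg).
  exact: sosD.
exact: sos_sqr.
Qed.

Let coord j : V -> R := fun t => t ord0 j.

Let theta_funs_coord j : theta_funs (coord j).
Proof. by apply: homogenizable_theta_funs; exact: homogenizable_coord. Qed.

Let fct1E t : (1 : V -> R) t = 1. Proof. by []. Qed.

Lemma denom_fctE : denom = 1 + \sum_(j < n) coord j ^+ 2 +
  \sum_(k < m) real_mpoly_fun (tnth p k) ^+ 2 :> (V -> R).
Proof. by apply/funext => t; rewrite !fctE !fct_sumE. Qed.

(** [theta = theta ^+ 2 * denom], and [denom] is a sum of squares by construction. *)
Lemma sos_theta : sos theta_funs (theta p).
Proof.
have AA := theta_funs_alg.
have -> : theta p = theta p ^+ 2 * denom.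
  by apply/funext => t; rewrite !fctE thetaE; field; exact: denom_neq0.
apply: (sosM AA); first by apply: sos_sqr; exact: theta_funs_theta.
rewrite denom_fctE -[1](expr1n _ 2).
apply: sosD; last by apply: sos_sqrs => k; exact: theta_funs_mpoly.
apply: sosD; last exact: sos_sqrs.
by apply: sos_sqr; exact: (A_cst AA).
Qed.

Lemma sos_denom_power K : sos theta_funs (denom ^+ K).
Proof.
apply: (sosX theta_funs_alg).
have -> : denom = theta p * denom ^+ 2.
  by apply/funext => t; rewrite !fctE thetaE; field; exact: denom_neq0.
apply: (sosM theta_funs_alg); first exact: sos_theta.
by apply: sos_sqr; exact: theta_funs_denom.
Qed.

(** [1 - theta = theta * (denom - 1)], and [denom - 1] is still a sum of squares. *)
Lemma sos_1theta : sos theta_funs (1 - theta p).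
Proof.
have -> : 1 - theta p = theta p * (\sum_(j < n) coord j ^+ 2 +
    \sum_(k < m) real_mpoly_fun (tnth p k) ^+ 2).
  have -> : \sum_(j < n) coord j ^+ 2 +
      \sum_(k < m) real_mpoly_fun (tnth p k) ^+ 2 = denom - 1.
    by rewrite denom_fctE; ring.
  by apply/funext => t; rewrite !fctE !fct1E thetaE; field; exact: denom_neq0.
apply: (sosM theta_funs_alg); first exact: sos_theta.
by apply: sosD; apply: sos_sqrs => // k; exact: theta_funs_mpoly.
Qed.

(** The sign [s] treats [boxed] and [1 - boxed] at once; the square of [1 + s t_j] absorbs the
    linear term. *)
Let sos_theta_coord (s : R) j : s ^+ 2 = 1 ->
  sos theta_funs (fun t => 2^-1 + s * (theta p t * t ord0 j)).
Proof.
move=> s2; have AA := theta_funs_alg.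
have -> : (fun t => 2^-1 + s * (theta p t * t ord0 j)) =
    2^-1 *: (theta p * ((1 + s *: coord j) ^+ 2 +
       \sum_(i < n | i != j) coord i ^+ 2 +
       \sum_(k < m) real_mpoly_fun (tnth p k) ^+ 2)).
  have -> : (1 + s *: coord j) ^+ 2 + \sum_(i < n | i != j) coord i ^+ 2 +
       \sum_(k < m) real_mpoly_fun (tnth p k) ^+ 2 = denom + (2 * s) *: coord j.
    rewrite denom_fctE [in RHS](bigD1 j)//=.
    have -> : (1 + s *: coord j) ^+ 2 =
        1 + (2 * s) *: coord j + (s ^+ 2) *: coord j ^+ 2.
      by apply/funext => t; rewrite !fctE ?fct1E /GRing.scale /=; ring.
    by rewrite s2 scale1r; ring.
  apply/funext => t; rewrite !fctE thetaE /GRing.scale /= /coord.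
  by field; exact: denom_neq0.
apply: (sosZ AA) => //; apply: (sosM AA); first exact: sos_theta.
apply: sosD; last by apply: sos_sqrs => k; exact: theta_funs_mpoly.
apply: sosD; last exact: sos_sqrs.
apply: sos_sqr; apply: (A_add AA); first exact: (A_cst AA).
exact: (A_scale AA).
Qed.

Lemma sos_boxed i : sos theta_funs (boxed i).
Proof.
rewrite /boxed; case: unliftP => [j _|_]; last exact: sos_theta.
have := @sos_theta_coord 1 j (expr1n _ _); congr sos.
by apply/funext => t; rewrite mul1r.
Qed.

Lemma sos_1boxed i : sos theta_funs (1 - boxed i).
Proof.
rewrite /boxed; case: unliftP => [j _|_]; last exact: sos_1theta.
have := @sos_theta_coord (-1) j (sqrr_sign _ 1); congr sos.
by apply/funext => t; rewrite !fctE fct1E; field.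
Qed.

(** Sums of squares are pointwise nonnegative, so both bounds come from the two preceding
    memberships. *)
Lemma boxed01 i t : 0 <= boxed i t <= 1.
Proof.
have sos_ge0_pt f : sos theta_funs f -> 0 <= f t.
  elim=> [g _|f' g _ hf _ hg]; first by rewrite !fctE sqr_ge0.
  by rewrite !fctE addr_ge0.
rewrite sos_ge0_pt//=; last exact: sos_boxed.
by have := sos_ge0_pt _ (sos_1boxed i); rewrite !fctE fct1E subr_ge0.
Qed.

End ThetaAlgebra.

(** * From the complex functional to a real one *)

Section RealPart.
Variables (R : realType) (n m : nat) (p : m.-tuple (mpoly.mpoly n R)).
Local Notation V := 'rV[R]_n.
Implicit Types (f g : V -> R) (F G : V -> R[i]).

Definition cplx f : V -> R[i] := fun t => (f t)%:C.

Section CplxInSubalgebra.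
Variable S : set (V -> R[i]).
Hypothesis S_alg : is_subalgebra S.
Hypothesis S_coord : forall j, S (fun t => (t ord0 j)%:C).
Hypothesis S_theta : S (cplx (theta p)).

Let S_mpoly q : S (cplx (real_mpoly_fun q)).
Proof.
rewrite /cplx /real_mpoly_fun; under eq_fun => t do rewrite mpoly.mevalE rmorph_sum.
apply: (subalgebra_sum _ S_alg) => // w; under eq_fun => t do rewrite rmorphM rmorph_prod.
apply: (subalgebraM S_alg) => //; first exact: (subalgebra_cst _ S_alg).
apply: (subalgebra_prod _ S_alg) => // i; under eq_fun => t do rewrite rmorphXn.
by apply: (subalgebraX _ S_alg); exact: S_coord.
Qed.

Let S_denom : S (cplx (denom p)).
Proof.
rewrite /cplx /denom; under eq_fun => t do rewrite !rmorphD !rmorph_sum.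
apply: (subalgebraD S_alg) => //; last first.
  apply: (subalgebra_sum _ S_alg) => // k; under eq_fun => t do rewrite rmorphXn.
  by apply: (subalgebraX _ S_alg) => //; exact: S_mpoly.
apply: (subalgebraD S_alg) => //; first exact: (subalgebra_cst _ S_alg).
apply: (subalgebra_sum _ S_alg) => // k; under eq_fun => t do rewrite rmorphXn.
by apply: (subalgebraX _ S_alg); exact: S_coord.
Qed.

Let S_boxed i : S (cplx (boxed p i)).
Proof.
rewrite /cplx /boxed; case: (unlift _ _) => [j|]; last exact: S_theta.
under eq_fun => t do rewrite rmorphD rmorphM.
apply: (subalgebraD S_alg) => //; first exact: (subalgebra_cst _ S_alg).
by apply: (subalgebraM S_alg); [exact: S_theta | exact: S_coord].
Qed.

Lemma subalgebra_cplx f : theta_funs p f -> S (cplx f).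
Proof.
move=> [K [q [s hs] fq]]; rewrite /cplx.
under eq_fun => t do rewrite fq rmorphM rmorphXn hs rmorph_sum.
apply: (subalgebraM S_alg) => //; first by apply: (subalgebraX _ S_alg); exact: S_denom.
apply: (subalgebra_sum _ S_alg) => // w; under eq_fun => t do rewrite rmorphM rmorph_prod.
apply: (subalgebraM S_alg) => //; first exact: (subalgebra_cst _ S_alg).
by apply: (subalgebra_prod _ S_alg) => i; exact: S_boxed.
Qed.

End CplxInSubalgebra.

Let S := R_theta p.

Let S_alg : is_subalgebra S. Proof. exact: generated_algebraP. Qed.

Lemma R_theta_cplx f : theta_funs p f -> R_theta p (cplx f).
Proof.
apply: subalgebra_cplx; first exact: S_alg.
  move=> j; apply: sub_generated_algebra; left.
  exists (mpoly.mpolyX R[i] (mpoly.mnm1 j)) => //.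
  by apply/funext => t; rewrite /complex_mpoly_fun mpoly.mevalXU.
by apply: sub_generated_algebra; right.
Qed.

Let theta_funs_ReIm F := theta_funs p (fun t => complex.Re (F t)) /\
  theta_funs p (fun t => complex.Im (F t)).

Let ReIm_alg : is_subalgebra theta_funs_ReIm.
Proof.
have AA := theta_funs_alg p; split.
- by split; exact: (A_cst AA).
- move=> a f g [f1 f2] [g1 g2]; split.
    have := A_add AA (A_sub AA (A_scale AA (complex.Re a) f1)
                               (A_scale AA (complex.Im a) f2)) g1.
    congr theta_funs; apply/funext => t.
    by rewrite !fctE; case: a (f t) (g t) => [? ?] [? ?] [? ?].
  have := A_add AA (A_add AA (A_scale AA (complex.Re a) f2)
                             (A_scale AA (complex.Im a) f1)) g2.
  congr theta_funs; apply/funext => t.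
  by rewrite !fctE; case: a (f t) (g t) => [? ?] [? ?] [? ?].
- move=> f g [f1 f2] [g1 g2]; split.
    have := A_sub AA (A_mul AA f1 g1) (A_mul AA f2 g2).
    congr theta_funs; apply/funext => t.
    by rewrite !fctE; case: (f t) (g t) => [? ?] [? ?].
  have := A_add AA (A_mul AA f1 g2) (A_mul AA f2 g1).
  congr theta_funs; apply/funext => t.
  by rewrite !fctE; case: (f t) (g t) => [? ?] [? ?].
Qed.

(** By minimality of the generated algebra: the functions with both parts in [theta_funs] form a
    subalgebra that contains the generators. *)
Lemma R_theta_ReIm F : R_theta p F ->
  theta_funs p (fun t => complex.Re (F t)) /\
  theta_funs p (fun t => complex.Im (F t)).
Proof.
move=> hF; apply: (hF theta_funs_ReIm); split; first exact: ReIm_alg.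
have AA := theta_funs_alg p.
move=> _ [[q _ <-]|->]; last by split; [exact: theta_funs_theta | exact: (A_cst AA)].
change (theta_funs_ReIm (complex_mpoly_fun q)).
rewrite /complex_mpoly_fun; under eq_fun do rewrite mpoly.mevalE.
apply: (subalgebra_sum _ ReIm_alg) => w; apply: (subalgebraM ReIm_alg).
  exact: (subalgebra_cst _ ReIm_alg).
apply: (subalgebra_prod _ ReIm_alg) => i; apply: (subalgebraX _ ReIm_alg).
split; last exact: (A_cst AA).
by apply: homogenizable_theta_funs; exact: homogenizable_coord.
Qed.

Variable Lambda : (V -> R[i]) -> R[i].
Hypothesis Lpsd : psd_map S Lambda.

Definition real_functional f : R := complex.Re (Lambda (cplx f)).

Let LamD a F G : S F -> S G ->
  Lambda (fun t => a * F t + G t) = a * Lambda F + Lambda G.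
Proof. by case: Lpsd => + _ _; apply. Qed.

Let Lam0 : Lambda (fun=> 0) = 0.
Proof.
have S0 : S (fun=> 0) by exact: (subalgebra_cst _ S_alg).
have := LamD (-1) S0 S0; rewrite (_ : (fun=> _) = fun=> 0).
  by move=> ->; rewrite mulN1r addNr.
by apply/funext => t; rewrite mulr0 addr0.
Qed.

Lemma real_functional_ge0 f : theta_funs p f -> 0 <= Lambda (cplx (f ^+ 2)).
Proof.
move=> hf; case: Lpsd => _ + _ => /(_ _ (R_theta_cplx hf)).
congr (_ <= Lambda _); apply/funext => t.
by rewrite /cplx fctE; congr Complex => /=; ring.
Qed.

Let cplxD f g : theta_funs p f -> theta_funs p g ->
  Lambda (cplx (f + g)) = Lambda (cplx f) + Lambda (cplx g).
Proof.
move=> hf hg; have := LamD 1 (R_theta_cplx hf) (R_theta_cplx hg).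
rewrite mul1r => <-; congr Lambda; apply/funext => t.
by rewrite mul1r /cplx -rmorphD.
Qed.

Let cplxZ c f : theta_funs p f ->
  Lambda (cplx (c *: f)) = c%:C * Lambda (cplx f).
Proof.
move=> hf; have S0 : S (fun=> 0) by exact: (subalgebra_cst _ S_alg).
have := LamD c%:C (R_theta_cplx hf) S0.
rewrite Lam0 addr0 => <-; congr Lambda; apply/funext => t.
by rewrite addr0 /cplx -rmorphM.
Qed.

(** [2 f = (f + 1) ^+ 2 - f ^+ 2 - 1], and positivity makes the value of [Lambda] on each real
    square real. *)
Lemma Lambda_cplx f : theta_funs p f -> Lambda (cplx f) = (real_functional f)%:C.
Proof.
move=> hf; have AA := theta_funs_alg p.
have A1 : theta_funs p (cst 1) by exact: (A_cst AA).
have real0 (z : R[i]) : 0 <= z -> complex.Im z = 0 by case: z => a b /andP[/eqP].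
suff h : complex.Im (Lambda (cplx f)) = 0.
  by rewrite /real_functional; case: (Lambda _) h => a b /= ->.
have := real0 _ (real_functional_ge0 (A_add AA hf A1)).
have -> : (f + cst 1) ^+ 2 = f ^+ 2 + (2 *: f + cst 1 ^+ 2).
  by apply/funext => t; rewrite !fctE /GRing.scale /=; ring.
have A2 := A_scale AA 2 hf; have A11 := A_exp AA 2 A1.
rewrite !cplxD ?(cplxZ 2 hf)//; [|exact: A_exp|exact: A_add].
have := real0 _ (real_functional_ge0 hf).
have := real0 _ (real_functional_ge0 A1).
case: (Lambda (cplx (f ^+ 2))) => a1 b1; case: (Lambda (cplx (cst 1 ^+ 2))) => a2 b2.
by case: (Lambda (cplx f)) => a3 b3 /= -> ->; lra.
Qed.

Lemma real_functional_pos : positive_functional (theta_funs p) real_functional.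
Proof.
split=> [f g hf hg|c f hf|f hf].
- by rewrite /real_functional cplxD//; case: (Lambda _) (Lambda _) => [? ?] [? ?].
- rewrite /real_functional cplxZ//; case: (Lambda _) => a b /=; ring.
- have := real_functional_ge0 hf; rewrite /real_functional.
  by case: (Lambda _) => a b /andP[].
Qed.

Lemma LambdaE F : S F -> Lambda F =
  Complex (real_functional (fun t => complex.Re (F t)))
          (real_functional (fun t => complex.Im (F t))).
Proof.
move=> /R_theta_ReIm[h1 h2].
have := LamD (Complex 0 1) (R_theta_cplx h2) (R_theta_cplx h1).
rewrite !Lambda_cplx// => LE.
transitivity (Lambda (fun t => Complex 0 1 * cplx (fun t => complex.Im (F t)) t +
    cplx (fun t => complex.Re (F t)) t)); last by rewrite LE; congr Complex => /=; ring.
congr Lambda; apply/funext => t; rewrite /cplx; case: (F t) => a b /=.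
by congr Complex => /=; ring.
Qed.

End RealPart.

(** * The representing measure *)

Section BorelCoordinates.
Variables (R : realType) (n : nat).
Local Notation V := 'rV[R]_n.

(** The inverse is continuous off 0, and the remaining set is a single point. *)
Lemma measurable_inv d (T : measurableType d) (D : set T) (f : T -> R) :
  measurable_fun D f -> measurable_fun D (fun x => (f x)^-1).
Proof.
apply: measurableT_comp; rewrite -(setUv [set 0 : R]).
apply/measurable_funU => //; first exact: measurableC.
split; first exact: measurable_fun_set1.
apply: open_continuous_measurable_fun; first exact/closed_openC/closed_eq.
move=> x; rewrite inE /= => x0; apply: inv_continuous.
exact/eqP.
Qed.

(** Every open set is a countable union of boxes with rational corners, and the preimage of a box is
    a finite intersection of coordinate conditions. *)
Lemma measurable_fun_rV d (T : measurableType d) (phi : T -> V) :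
  (forall j, measurable_fun setT (fun x => phi x ord0 j)) ->
  measurable_fun setT (phi : T -> borelRn R n).
Proof.
move=> mphi; apply: (measurability (@open V : set (set (borelRn R n)))) => //.
move=> _ [U oU <-]; rewrite setTI.
pose box (ab : 'rV[rat]_n * 'rV[rat]_n) : set V :=
  [set t | forall j, ratr (ab.1 ord0 j) < t ord0 j < ratr (ab.2 ord0 j)].
(* Boxes not contained in [U] are replaced by the empty set, so that the union runs over a whole
   countable type. *)
pose F ab := phi @^-1` (if `[< box ab `<=` U >] then box ab else set0).
have -> : phi @^-1` U = \bigcup_ab F ab.
  apply/seteqP; split=> [x Ux|x [ab _]]; last first.
    by rewrite /F /=; case: asboolP => // + h; apply.
  have /nbhs_ballP[e e0 he] : nbhs (phi x) U by exact: open_nbhs_nbhs.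
  have ha j : exists q : rat, phi x ord0 j - e < ratr q < phi x ord0 j.
    have [|q] := @rat_in_itvoo _ (phi x ord0 j - e) (phi x ord0 j).
      by rewrite ltrBlDr ltrDl.
    by rewrite in_itv /=; exists q.
  have hb j : exists q : rat, phi x ord0 j < ratr q < phi x ord0 j + e.
    have [|q] := @rat_in_itvoo _ (phi x ord0 j) (phi x ord0 j + e).
      by rewrite ltrDl.
    by rewrite in_itv /=; exists q.
  pose ab := (\row_j xchoose (ha j), \row_j xchoose (hb j)).
  have hab j : [/\ phi x ord0 j - e < ratr (ab.1 ord0 j),
      ratr (ab.1 ord0 j) < phi x ord0 j, phi x ord0 j < ratr (ab.2 ord0 j) &
      ratr (ab.2 ord0 j) < phi x ord0 j + e].
    rewrite !mxE; have /andP[h1 h2] := xchooseP (ha j).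
    by have /andP[h3 h4] := xchooseP (hb j).
  exists ab => //; rewrite /F; case: asboolP => [_ j|]; last first.
    move=> []; apply: subset_trans he => t ht; split=> // i j; rewrite ord1.
    have [h1 h2 h3 h4] := hab j; have /andP[h5 h6] := ht j.
    by rewrite /ball /= ltr_distlC; apply/andP; split; lra.
  by have [h1 h2 h3 h4] := hab j; apply/andP.
apply: countable_bigcupT_measurable => [|ab]; first exact: countableP.
rewrite /F; case: asboolP => _; last by rewrite preimage_set0.
have -> : phi @^-1` box ab = \bigcap_(j in [set: 'I_n])
    [set x | ratr (ab.1 ord0 j) < phi x ord0 j < ratr (ab.2 ord0 j)].
  by apply/seteqP; split=> [x h j _|x h j]; [exact: h | exact: (h j I)].
apply: fin_bigcap_measurable => // j _.
have := mphi j measurableT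
  `]ratr (ab.1 ord0 j), ratr (ab.2 ord0 j)[%classic (measurable_itv _).
by rewrite setTI; congr measurable; apply/funext => x; rewrite /= in_itv.
Qed.

Lemma measurable_coord j : measurable_fun setT (fun t : borelRn R n => (t : V) ord0 j).
Proof.
apply: (measurability _ (RGenOpens.measurableE R)) => _ [_ [a [b ->] <-]].
rewrite setTI; apply: sub_sigma_algebra.
by apply: open_comp; [move=> t _; exact: coord_continuous | exact: interval_open].
Qed.

End BorelCoordinates.

(** * Borel measurability of the functions of the algebra *)

Section MeasurableThetaFuns.
Variables (R : realType) (n m : nat) (p : m.-tuple (mpoly.mpoly n R)).
Local Notation V := 'rV[R]_n.
Local Notation B := (borelRn R n).

Lemma measurable_polyf N d (T : measurableType d) (X : 'I_N -> T -> R) q :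
  (forall i, measurable_fun setT (X i)) -> polyf q ->
  measurable_fun setT (fun u => q (X ^~ u)).
Proof.
move=> mX [s hs]; under eq_fun do rewrite hs.
apply: measurable_sum => w; apply: measurable_funM; first exact: measurable_cst.
by apply: measurable_prod.
Qed.

Let mcoord j : measurable_fun setT (fun t : B => (t : V) ord0 j).
Proof. exact: measurable_coord. Qed.

Lemma measurable_mpoly q : measurable_fun setT (real_mpoly_fun q : B -> R).
Proof.
rewrite /real_mpoly_fun; under eq_fun do rewrite mpoly.mevalE.
apply: measurable_sum => w; apply: measurable_funM; first exact: measurable_cst.
by apply: measurable_prod => i _; apply: measurable_funX.
Qed.

Lemma measurable_denom : measurable_fun setT (denom p : B -> R).
Proof.
apply: measurable_funD; last first.
  by apply: measurable_sum => k; apply: measurable_funX; exact: measurable_mpoly.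
apply: measurable_funD; first exact: measurable_cst.
by apply: measurable_sum => j; exact: measurable_funX.
Qed.

Lemma measurable_theta : measurable_fun setT (theta p : B -> R).
Proof. by apply: measurable_inv; exact: measurable_denom. Qed.

Lemma measurable_boxed i : measurable_fun setT (boxed p i : B -> R).
Proof.
rewrite /boxed; case: (unlift _ _) => [j|]; last exact: measurable_theta.
apply: measurable_funD; first exact: measurable_cst.
by apply: measurable_funM; [exact: measurable_theta | exact: mcoord].
Qed.

Lemma measurable_theta_funs f : theta_funs p f -> measurable_fun setT (f : B -> R).
Proof.
move=> [K [q hq fq]].
have -> : f = (fun t => denom p t ^+ K * q (boxed p ^~ t)) by exact/funext.
apply: measurable_funM; first by apply: measurable_funX; exact: measurable_denom.
apply: (measurable_polyf (X := fun i => boxed p i : B -> R)) => // i.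
exact: measurable_boxed.
Qed.

End MeasurableThetaFuns.

(** * The law of the process and its integrals *)

Section Law.
Variables (R : realType) (n m : nat) (p : m.-tuple (mpoly.mpoly n R)).
Local Notation V := 'rV[R]_n.
Local Notation B := (borelRn R n).
Variable l : (V -> R) -> R.
Hypothesis lpos : positive_functional (theta_funs p) l.

Let AA := theta_funs_alg p.
Let A1 : theta_funs p 1. Proof. exact: (A_cst AA). Qed.
Let Aq : theta_funs p (1 - theta p).
Proof. by apply: (A_sub AA) => //; exact: theta_funs_theta. Qed.
Let AD := theta_funs_denom p.
Let At := theta_funs_theta p.

(** Since [denom * theta = 1], the values of [l] at [(1 - theta) ^+ i] are the successive
    differences of its values at [denom * (1 - theta) ^+ i]. Their sum telescopes below [l denom],
    and they decrease in [i]. *)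
Lemma functional_small_powers j : j.+1%:R * l ((1 - theta p) ^+ j) <= l (denom p).
Proof.
pose e i := l ((1 - theta p) ^+ i); pose E i := l (denom p * (1 - theta p) ^+ i).
have Ae i : theta_funs p ((1 - theta p) ^+ i) by exact: (A_exp AA).
have AE i : theta_funs p (denom p * (1 - theta p) ^+ i) by exact: (A_mul AA).
have E0 i : 0 <= E i.
  apply: (sos_ge0 AA lpos); apply: (sosM AA); first exact: (sos_denom_power p 1).
  by apply: (sosX AA); exact: sos_1theta.
have eS i : e i.+1 <= e i.
  rewrite -subr_ge0 /e -(lB AA lpos)//; apply: (sos_ge0 AA lpos).
  have -> : (1 - theta p) ^+ i - (1 - theta p) ^+ i.+1 =
      (1 - theta p) ^+ i * theta p by rewrite exprS; ring.
  apply: (sosM AA); last exact: sos_theta.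
  by apply: (sosX AA); exact: sos_1theta.
have ES i : E i - E i.+1 = e i.
  rewrite /E -(lB AA lpos)//; congr l; apply/funext => t; rewrite !fctE exprS.
  by rewrite -[(1 : V -> R) t]/(1 : R) thetaE; field; exact: denom_neq0.
have ej i : (i <= j)%N -> e j <= e i.
  move=> /subnKC <-; elim: (j - i)%N => [|k IH]; first by rewrite addn0.
  by rewrite addnS (le_trans (eS _)).
have : j.+1%:R * e j <= \sum_(0 <= i < j.+1) e i.
  rewrite mulr_natl -[X in _ *+ X]subn0 -sumr_const_nat.
  apply: ler_sum_nat => i /andP[_ ij].
  exact: ej.
move/le_trans; apply.
have -> : \sum_(0 <= i < j.+1) e i = E 0%N - E j.+1.
  elim: j.+1 => [|k IH]; first by rewrite big_geq// subrr.
  by rewrite big_nat_recr//= IH -ES; ring.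
have -> : l (denom p) = E 0%N by rewrite /E expr0 mulr1.
by rewrite gerBl.
Qed.

(** Cauchy-Schwarz for [l]: by the preceding bound, [l ((1 - theta) ^+ (2 j))] is of order
    [1 / j]. *)
Lemma functional_small_powers_cvg f : theta_funs p f ->
  (fun j => l (f * (1 - theta p) ^+ j)) @ \oo --> (0 : R).
Proof.
move=> Af; pose C := l (f ^+ 2) * l (denom p).
have Ae i : theta_funs p ((1 - theta p) ^+ i) by exact: (A_exp AA).
have bound j : l (f * (1 - theta p) ^+ j) ^+ 2 <= C / j.+1%:R.
  apply: (le_trans (l_CauchySchwarz AA lpos Af (Ae j))).
  rewrite /C -mulrA ler_wpM2l//; first by case: lpos => _ _; apply.
  rewrite -exprM ler_pdivlMr ?ltr0n//.
  apply: le_trans (functional_small_powers (j * 2)).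
  rewrite mulrC ler_wpM2r//; last by rewrite ler_nat ltnS leq_pmulr.
  by apply: (sos_ge0 AA lpos); apply: (sosX AA); exact: sos_1theta.
have sq0 : (fun j => l (f * (1 - theta p) ^+ j) ^+ 2) @ \oo --> (0 : R).
  apply: (@squeeze_cvgr _ _ _ _ (fun=> 0) (fun j => C * j.+1%:R^-1)).
  - by apply: nearW => j; rewrite sqr_ge0 bound.
  - exact: cvg_cst.
  - rewrite -[X in _ --> X](mulr0 C); apply: cvgMr; exact: cvg_harmonic.
apply: norm_cvg0; rewrite -(sqrtr0 R).
under eq_fun do rewrite -sqrtr_sqr.
exact: (continuous_cvg _ (@sqrt_continuous R 0) sq0).
Qed.

Section WithProcess.
Variables (P : {measure set (measurableTypeR R) -> \bar R})
  (X : 'I_n.+1 -> measurableTypeR R -> R).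
Hypotheses (Pfin : (P setT < +oo)%E) (bX : forall i, bmeas (X i))
  (X01 : forall i u, 0 <= X i u <= 1).
Hypothesis Xmoments : forall L : seq 'I_n.+1,
  \int[P]_u (\prod_(i <- L) X i u) = l (\prod_(i <- L) boxed p i).

Lemma bmeas_polyf_process q : polyf q -> bmeas (fun u => q (X ^~ u)).
Proof.
move=> [s hs]; under eq_fun do rewrite hs.
by apply: bmeas_sum => w; apply: bmeasZ; exact: bmeas_prod.
Qed.

Lemma Rintegral_polyf_process q : polyf q ->
  \int[P]_u q (X ^~ u) = l (fun t => q (boxed p ^~ t)).
Proof.
move=> [s hs]; under eq_Rintegral do rewrite hs.
rewrite Rintegral_sum//; last by move=> w; apply: bmeasZ; exact: bmeas_prod.
have -> : (fun t => q (boxed p ^~ t)) =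
    \sum_(w <- s) w.1 *: \prod_(i <- w.2) boxed p i.
  apply/funext => t; rewrite hs fct_sumE; apply: eq_bigr => w _.
  by rewrite !fctE fct_prodE.
have Aprod L : theta_funs p (\prod_(i <- L) boxed p i).
  by apply: (A_prod AA) => i; exact: theta_funs_boxed.
rewrite (l_sum AA lpos) => [|w]; last exact: (A_scale AA).
apply: eq_bigr => w _; rewrite RintegralZ ?Xmoments ?(lZ lpos)//.
by apply: bmeas_integrable => //; exact: bmeas_prod.
Qed.

Let X0 := X ord0.

(** On the set [X0 = 0] every power [(1 - X0) ^+ j] equals 1, so the measure of this set is at most
    [l ((1 - theta) ^+ j)], which tends to 0. *)
Lemma ae_process_neq0 : {ae P, forall u, X0 u != 0}.
Proof.
pose Z := [set u | X0 u = 0].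
have mZ : measurable (Z : set (measurableTypeR R)).
  have := (bX ord0).1 measurableT [set 0] (measurable_set1 _).
  by rewrite setTI.
exists Z; split=> //; last by move=> u /= /negP; rewrite negbK => /eqP.
have PZfin : P Z \is a fin_num.
  by rewrite ge0_fin_numE// (le_lt_trans _ Pfin)// le_measure ?inE.
suff : fine (P Z) <= 0.
  by rewrite -lee_fin fineK// => h; apply/eqP; rewrite eq_le h measure_ge0.
have key j : j.+1%:R * fine (P Z) <= l (denom p).
  apply: (le_trans _ (functional_small_powers j)); rewrite ler_wpM2l//.
  have -> : l ((1 - theta p) ^+ j) = \int[P]_u ((1 - X0 u) ^+ j).
    pose q (x : 'I_n.+1 -> R) := (1 + (-1) * x ord0) ^+ j.
    have hq : polyf q.
      apply: polyfX; apply: polyfD; first exact: polyf_cst.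
      by apply: polyfZ; exact: polyf_var.
    transitivity (\int[P]_u q (X ^~ u)); last first.
      by apply: eq_Rintegral => u _; rewrite /q mulN1r.
    rewrite (Rintegral_polyf_process hq); congr l; apply/funext => t.
    by rewrite /q !fctE boxed0 mulN1r.
  rewrite -Rintegral_indic//; apply: le_Rintegral => //.
  - by apply: bmeas_integrable => //; exact: bmeas_indic.
  - apply: bmeas_integrable => //; apply: bmeasX.
    by apply: bmeasB; [exact: bmeas_cst | exact: bX].
  - move=> u _; rewrite indicE; have /andP[x0 x1] := X01 ord0 u.
    case: (boolP (u \in Z)) => [/set_mem Zu|_].
      by rewrite /X0 [X ord0 u]Zu subr0 expr1n.
    by rewrite exprn_ge0// subr_ge0.
rewrite leNgt; apply/negP => PZ0.
have := key (Num.bound (l (denom p) / fine (P Z))).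
rewrite leNgt => /negP; apply; rewrite -ltr_pdivrMr//.
apply: (lt_le_trans (archi_boundP _)).
  rewrite divr_ge0 ?(ltW PZ0)//; apply: (sos_ge0 AA lpos).
  exact: (sos_denom_power p 1).
by rewrite ler_nat.
Qed.

Definition unboxed_process u : V := unboxed (X ^~ u).
Local Notation tau := unboxed_process.

(** The process almost surely lies in the image of [boxed]; the relation to verify is
    [X0 * denom (tau u) = 1]. *)
Lemma ae_boxed_process : {ae P, forall u i, boxed p i (tau u) = X i u}.
Proof.
have [K [q [hq qD]]] := homogenizable_denom p.
(* At [x = boxed t] one has [q x = x ord0 ^+ K * denom t] and [x ord0 * denom t = 1]. The square [r]
   vanishes there, so its integral along the process is [l 0 = 0]. *)
pose r (x : 'I_n.+1 -> R) := (x ord0 ^+ K + (-1) * (x ord0 * q x)) ^+ 2.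
have hr : polyf r.
  apply: polyfX; apply: polyfD; first by apply: polyfX; exact: polyf_var.
  by apply: polyfZ; apply: polyfM => //; exact: polyf_var.
have r0 : {ae P, forall u, r (X ^~ u) = 0}.
  have br := bmeas_polyf_process hr.
  have ir := bmeas_integrable Pfin br.
  have ir0 : (\int[P]_u `|(r (X ^~ u))%:E| = 0)%E.
    transitivity (\int[P]_u (r (X ^~ u))%:E)%E.
      by apply: eq_integral => u _; rewrite gee0_abs// lee_fin sqr_ge0.
    rewrite -[LHS]fineK; last exact: integrable_fin_num.
    rewrite -[fine _]/(Rintegral P setT (fun u => r (X ^~ u))).
    rewrite Rintegral_polyf_process// (_ : (fun _ => _) = 0) ?(l0 AA lpos)//.
    apply/funext => t; rewrite /r -qD; last first.
      by rewrite boxed0 gt_eqF// theta_gt0.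
    rewrite boxedK boxed0 mulN1r mulrCA thetaE mulVf ?denom_neq0//.
    by rewrite mulr1 subrr expr0n.
  have mr : measurable_fun setT (fun u => (r (X ^~ u))%:E).
    by apply/measurable_EFinP; exact: br.1.
  have := (ae_eq_integral_abs P measurableT mr).1 ir0.
  by apply: filterS => u /(_ I) [].
apply: filterS2 ae_process_neq0 r0 => u x0.
rewrite /r -qD// => /eqP; rewrite sqrf_eq0 mulN1r => /eqP h.
have th : theta p (tau u) = X0 u.
  have : X0 u ^+ K * (1 - X0 u * denom p (tau u)) = 0.
    by rewrite -[RHS]h /tau /X0; ring.
  move=> /eqP; rewrite mulf_eq0 expf_eq0 (negbTE x0) andbF /= subr_eq0 => /eqP h1.
  by rewrite thetaE -[LHS]mul1r h1 mulfK// denom_neq0.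
move=> i; rewrite /boxed; case: unliftP => [j ->|->]; rewrite th//.
by rewrite /tau mxE -/X0 mulrC divfK// addrC subrK.
Qed.

Lemma measurable_unboxed_process :
  measurable_fun setT (tau : measurableTypeR R -> B).
Proof.
apply: measurable_fun_rV => j; rewrite /tau; under eq_fun do rewrite mxE.
apply: measurable_funM; last by apply: measurable_inv; exact: (bX ord0).1.
by apply: measurable_funB; [exact: (bX _).1 | exact: measurable_cst].
Qed.

Lemma measurable_theta_funs_process f : theta_funs p f ->
  measurable_fun setT (fun u => (f (tau u))%:E).
Proof.
move=> Af; apply/measurable_EFinP.
exact: (measurableT_comp (measurable_theta_funs Af) measurable_unboxed_process).
Qed.

Let integral_EFin f c : P.-integrable setT (fun u => (f (tau u))%:E) ->
  \int[P]_u f (tau u) = c -> (\int[P]_u (f (tau u))%:E = c%:E)%E.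
Proof. by move=> i <-; rewrite /Rintegral fineK//; exact: integrable_fin_num. Qed.

(** Level 0 is the moment identity. A nonnegative [g] of level [K.+1] is the increasing limit of the
    functions [g * (1 - (1 - theta) ^+ j)] of level [K]; monotone convergence handles the integrals
    and [functional_small_powers_cvg] handles [l]. A general function is a difference of two
    nonnegative ones. *)
Lemma Rintegral_theta_fun K f : theta_fun p K f ->
  P.-integrable setT (fun u => (f (tau u))%:E) /\ \int[P]_u f (tau u) = l f.
Proof.
elim: K f => [|K IH] f.
  move=> [q hq fq].
  have E : {ae P, forall u, setT u -> (q (X ^~ u))%:E = (f (tau u))%:E}.
    move: ae_boxed_process; apply: filterS => u hu _.
    by rewrite fq mul1r; congr (q _)%:E; apply/funext => i; rewrite hu.
  have bq := bmeas_polyf_process hq.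
  have mq : measurable_fun setT (fun u => (q (X ^~ u))%:E).
    by apply/measurable_EFinP; exact: bq.1.
  have Af : theta_funs p f by exists 0%N, q.
  have mf := measurable_theta_funs_process Af.
  have iq := bmeas_integrable Pfin bq.
  have iE : (\int[P]_u (q (X ^~ u))%:E = \int[P]_u (f (tau u))%:E)%E.
    exact: ae_eq_integral.
  split; last first.
    rewrite /Rintegral -iE -[fine _]/(Rintegral P setT (fun u => q (X ^~ u))).
    rewrite Rintegral_polyf_process//; congr l; apply/funext => t.
    by rewrite fq mul1r.
  apply/integrableP; split=> //.
  have /integrableP[_] := iq; congr (_ < _)%E; apply: ae_eq_integral => //.
  - by apply: measurableT_comp => //; exact: abse_measurable.
  - by apply: measurableT_comp => //; exact: abse_measurable.
  - by move: E; apply: filterS => u hu uT; congr (`|_|%E); exact: hu.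
have nonneg g : (forall t, 0 <= g t) -> theta_fun p K.+1 g ->
    P.-integrable setT (fun u => (g (tau u))%:E) /\ \int[P]_u g (tau u) = l g.
  move=> g0 hg; have Ag : theta_funs p g by exists K.+1.
  pose h j : V -> R := g * (1 - (1 - theta p) ^+ j).
  have Aj j : theta_funs p ((1 - theta p) ^+ j) by exact: (A_exp AA).
  have h_in j : theta_fun p K (h j).
    elim: j => [|j IHj].
      rewrite /h expr0 subrr mulr0; have := @theta_fun_poly R n m p K _ (polyf_cst _ 0).
      by congr theta_fun.
    (* The increment is [theta * g], which lies one level lower, times a polynomial in [theta], of
       level 0. *)
    have -> : h j.+1 = h j + (theta p * g) * (1 - theta p) ^+ j.
      by rewrite /h exprS; ring.
    apply: theta_funD => //; rewrite -[K]addn0; apply: theta_funM.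
      exact: theta_funS.
    exists (fun x => (1 + (-1) * x ord0) ^+ j).
      apply: polyfX; apply: polyfD; first exact: polyf_cst.
      by apply: polyfZ; exact: polyf_var.
    by move=> t; rewrite expr0 mul1r !fctE boxed0 mulN1r.
  have hint j := IH _ (h_in j).
  have hE j t : h j t = g t * (1 - (1 - theta p t) ^+ j) by rewrite /h !fctE.
  have pow01 j t : 0 <= (1 - theta p t) ^+ j <= 1.
    have q0 : 0 <= 1 - theta p t by rewrite subr_ge0 theta_le1.
    rewrite exprn_ge0//= exprn_ile1// gerBl; exact/ltW/theta_gt0.
  have h_lim : (fun j => l (h j)) @ \oo --> l g.
    rewrite -[l g]subr0; under eq_fun => j.
      have -> : h j = g - g * (1 - theta p) ^+ j by rewrite /h mulrBr mulr1.
      rewrite (lB AA lpos)//; last exact: (A_mul AA).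
      over.
    by apply: cvgB; [exact: cvg_cst | exact: functional_small_powers_cvg].
  have h_cvg u : (fun j => (h j (tau u))%:E) @ \oo --> (g (tau u))%:E.
    have hc : (fun j => g (tau u) * (1 - (1 - theta p (tau u)) ^+ j)) @ \oo -->
        g (tau u) * (1 - 0).
      apply: cvgMr; apply: cvgB; first exact: cvg_cst.
      apply: cvg_expr; rewrite ger0_norm ?subr_ge0 ?theta_le1// gtrBl.
      exact: theta_gt0.
    apply: cvg_EFin; first exact: nearW.
    by move: hc; rewrite subr0 mulr1; under eq_fun do rewrite -hE.
  have gE : (\int[P]_u (g (tau u))%:E = (l g)%:E)%E.
    transitivity (\int[P]_u limn (fun j => (h j (tau u))%:E))%E.
      by apply: eq_integral => u _; apply/esym/cvg_lim => //; exact: h_cvg.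
    rewrite monotone_convergence//.
    - apply/cvg_lim => //; under eq_fun => j.
        rewrite (integral_EFin (hint j).1 (hint j).2); over.
      by apply: cvg_EFin => //; exact: nearW.
    - by move=> j; apply: measurable_theta_funs_process; exists K.
    - move=> j u _; rewrite lee_fin hE mulr_ge0// subr_ge0.
      by have /andP[] := pow01 j (tau u).
    - move=> u _ i j ij; rewrite lee_fin !hE ler_wpM2l// lerB//.
      apply: ler_wiXn2l => //; first by rewrite subr_ge0 theta_le1.
      by rewrite gerBl; exact/ltW/theta_gt0.
  split; last by rewrite /Rintegral gE.
  apply/integrableP; split; first exact: measurable_theta_funs_process.
  rewrite (eq_integral (fun u => (g (tau u))%:E)) ?gE ?ltry// => u _.
  by rewrite gee0_abs// lee_fin.
move=> hf; have [q hq fq] := hf; have [M hM] := polyf_bounded hq.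
have Mb t : `|q (boxed p ^~ t)| <= M by apply: hM => i; exact: boxed01.
have M0 : 0 <= M by apply: (le_trans _ (Mb 0)).
(* As [M] bounds [q] on the image of [boxed], both [g2] and [f + g2] are nonnegative. *)
pose g2 : V -> R := M *: (denom p ^+ K.+1).
have hg2 : theta_fun p K.+1 g2.
  by exists (fun=> M) => [|t]; [exact: polyf_cst | rewrite /g2 !fctE mulrC].
have D0 t : 0 <= denom p t ^+ K.+1 by rewrite exprn_ge0// ltW// denom_gt0.
have [i1 e1] : P.-integrable setT (fun u => ((f + g2) (tau u))%:E) /\
    \int[P]_u (f + g2) (tau u) = l (f + g2).
  apply: nonneg; last exact: theta_funD.
  move=> t; rewrite /g2 !fctE fq mulrC -mulrDl mulr_ge0// -lerBlDr sub0r.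
  by have := Mb t; rewrite ler_norml => /andP[].
have [i2 e2] : P.-integrable setT (fun u => (g2 (tau u))%:E) /\
    \int[P]_u g2 (tau u) = l g2.
  by apply: nonneg => // t; rewrite /g2 !fctE mulr_ge0.
have Af : theta_funs p f by exists K.+1.
have Ag2 : theta_funs p g2 by exists K.+1.
have fE : (fun u => f (tau u)) = (fun u => (f + g2) (tau u) - g2 (tau u)).
  by apply/funext => u; rewrite !fctE addrK.
split; last by rewrite fE RintegralB// e1 e2 (lD lpos)// addrK.
have := integrableB measurableT i1 i2.
apply: eq_integrable => // u _ /=.
by rewrite -EFinB; congr EFin; rewrite !fctE addrK.
Qed.

End WithProcess.

(** The measure is the image of [P] under [unboxed_process]. *)
Theorem theta_funs_representation :
  exists mu : {measure set B -> \bar R}, (mu setT < +oo)%E /\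
    forall f, theta_funs p f ->
      mu.-integrable setT (EFin \o f) /\ \int[mu]_t f t = l f.
Proof.
have [P [X [Pfin bX X01 Xmom]]] :=
  moment_process AA lpos (sos_boxed p) (sos_1boxed p).
have mtau := measurable_unboxed_process bX.
exists (measure_function_pushforward__canonical__measure_function_Measure P mtau).
split; first by rewrite /= /pushforward preimage_setT.
move=> f [K hf].
have Af : theta_funs p f by exists K.
have [i e] := Rintegral_theta_fun Pfin bX X01 Xmom hf.
have mf : measurable_fun setT (EFin \o f : B -> \bar R).
  by apply/measurable_EFinP; exact: measurable_theta_funs Af.
split; first exact: integrable_pushforward.
rewrite -e /Rintegral; congr fine.
exact: integral_pushforward.
Qed.

End Law.

(** * Square approximation by an algebra of bounded functions *)

Section SquareApproximation.
Context d (T : measurableType d) (R : realType).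
Variable mu : {measure set T -> \bar R}.
Hypothesis mufin : (mu setT < +oo)%E.
Variable A : set (T -> R).
Hypothesis A_bmeas : forall a, A a -> bmeas a.
Hypothesis A_alg : real_subalgebra A.
Implicit Types (f g h : T -> R).

Definition sqint f : \bar R := (\int[mu]_x ((f x) ^+ 2)%:E)%E.

Definition sq_approx h := measurable_fun setT h /\
  forall e, 0 < e -> exists2 a, A a & (sqint (h - a)%R < e%:E)%E.

Let msq f : measurable_fun setT f -> measurable_fun setT (fun x => ((f x) ^+ 2)%:E).
Proof. by move=> mf; apply/measurable_EFinP; exact: measurable_funX. Qed.

Let A_meas a : A a -> measurable_fun setT a.
Proof. by move=> /A_bmeas[]. Qed.

Lemma sqint_ge0 f : (0 <= sqint f)%E.
Proof. by apply: integral_ge0 => x _; rewrite lee_fin sqr_ge0. Qed.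

Lemma sqint_le f g (c : R) : measurable_fun setT f -> measurable_fun setT g ->
  0 <= c -> (forall x, f x ^+ 2 <= c * g x ^+ 2) -> (sqint f <= c%:E * sqint g)%E.
Proof.
move=> mf mg c0 fg; rewrite /sqint -ge0_integralZl_EFin//; last exact: msq.
  apply: ge0_le_integral => //.
  - by move=> x _; rewrite lee_fin sqr_ge0.
  - exact: msq.
  - by apply: measurable_funeM; exact: msq.
  - by move=> x _; rewrite -EFinM lee_fin.
by move=> x _; rewrite lee_fin sqr_ge0.
Qed.

Lemma sqint_leD f g h (c : R) : measurable_fun setT f -> measurable_fun setT g ->
  measurable_fun setT h -> 0 <= c ->
  (forall x, f x ^+ 2 <= c * (g x ^+ 2 + h x ^+ 2)) ->
  (sqint f <= c%:E * (sqint g + sqint h))%E.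
Proof.
move=> mf mg mh c0 fgh; rewrite /sqint -ge0_integralD//; try exact: msq.
- rewrite -ge0_integralZl_EFin//.
  + apply: ge0_le_integral => //.
    * by move=> x _; rewrite lee_fin sqr_ge0.
    * exact: msq.
    * by apply: measurable_funeM; apply: emeasurable_funD; exact: msq.
    * by move=> x _; rewrite -EFinD -EFinM lee_fin.
  + by move=> x _; rewrite -EFinD lee_fin addr_ge0// sqr_ge0.
  + by apply: emeasurable_funD; exact: msq.
- by move=> x _; rewrite lee_fin sqr_ge0.
- by move=> x _; rewrite lee_fin sqr_ge0.
Qed.

Let sqrD_le (x y : R) : (x + y) ^+ 2 <= 2 * (x ^+ 2 + y ^+ 2).
Proof.
rewrite -subr_ge0.
have -> : 2 * (x ^+ 2 + y ^+ 2) - (x + y) ^+ 2 = (x - y) ^+ 2 by ring.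
exact: sqr_ge0.
Qed.

Let lt_double (x y : \bar R) (e c : R) : 0 < c -> (x < (e / (2 * c))%:E)%E ->
  (y < (e / (2 * c))%:E)%E -> (c%:E * (x + y) < e%:E)%E.
Proof.
move=> c0 hx hy; rewrite -lte_pdivlMl//.
have -> : e = c * (e / (2 * c) + e / (2 * c)) by field; rewrite gt_eqF.
by rewrite -EFinM mulKf ?gt_eqF// EFinD lteD.
Qed.

(** [(x + y) ^+ 2 <= 2 * (x ^+ 2 + y ^+ 2)] stands in for the triangle inequality and avoids square
    roots; hence the tolerance [e / 4]. *)
Lemma sq_approx_closed h : measurable_fun setT h ->
  (forall e, 0 < e -> exists2 g, sq_approx g & (sqint (h - g)%R < e%:E)%E) ->
  sq_approx h.
Proof.
move=> mh happ; split=> // e e0.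
have e4 : 0 < e / (2 * 2) by rewrite divr_gt0// mulr_gt0.
have [g [mg gapp] hg] := happ _ e4; have [a Aa ga] := gapp _ e4.
exists a => //; apply: le_lt_trans (lt_double _ hg ga) => //.
apply: sqint_leD => //; try (apply: measurable_funB => //; exact: A_meas).
move=> x; rewrite !fctE; have := sqrD_le (h x - g x) (g x - a x).
by rewrite addrA subrK.
Qed.

Lemma sq_approx_A a : A a -> sq_approx a.
Proof.
move=> Aa; split=> [|e e0]; first exact: A_meas.
exists a => //; rewrite subrr /sqint integral0_eq ?lte_fin// => x _.
by rewrite /= expr0n.
Qed.

Lemma sq_approxD f g : sq_approx f -> sq_approx g -> sq_approx (f + g).
Proof.
move=> [mf af] [mg ag]; split=> [|e e0]; first exact: measurable_funD.
have e4 : 0 < e / (2 * 2) by rewrite divr_gt0// mulr_gt0.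
have [a Aa fa] := af _ e4; have [b Ab gb] := ag _ e4.
exists (a + b); first exact: (A_add A_alg).
apply: le_lt_trans (lt_double _ fa gb) => //.
apply: sqint_leD => //; try (apply: measurable_funB => //; exact: A_meas).
  apply: measurable_funB; first exact: measurable_funD.
  by apply: measurable_funD; exact: A_meas.
move=> x; rewrite !fctE; have := sqrD_le (f x - a x) (g x - b x).
by congr (_ ^+ 2 <= _); ring.
Qed.

(** [f g - a b = f (g - b) + b (f - a)]. The tolerance for [a] depends on the bound [N] of [b], so
    [b] is chosen first; adding 1 to the squared bounds keeps the divisors positive. *)
Lemma sq_approxM f g : sq_approx f -> bmeas f -> sq_approx g -> sq_approx (f * g).
Proof.
move=> [mf af] [_ [M hM]] [mg ag]; split=> [|e e0]; first exact: measurable_funM.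
have M1 : 0 < M ^+ 2 + 1 by rewrite ltr_wpDl// sqr_ge0.
have eM : 0 < e / (2 * (2 * (M ^+ 2 + 1))) by rewrite divr_gt0// !mulr_gt0.
have [b Ab gb] := ag _ eM.
have [mb [N hN]] := A_bmeas Ab.
have N1 : 0 < N ^+ 2 + 1 by rewrite ltr_wpDl// sqr_ge0.
have eN : 0 < e / (2 * 2) / (N ^+ 2 + 1) by rewrite !divr_gt0// mulr_gt0.
have [a Aa fa] := af _ eN; have ma := A_meas Aa.
exists (a * b); first exact: (A_mul A_alg).
pose u x := f x * (g x - b x); pose v x := b x * (f x - a x).
have mu_ : measurable_fun setT u by apply: measurable_funM => //; exact: measurable_funB.
have mv : measurable_fun setT v by apply: measurable_funM => //; exact: measurable_funB.
have sqle (x y : R) : `|x| <= y -> x ^+ 2 <= y ^+ 2 + 1.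
  move=> xy; rewrite -(real_normK (num_real x)).
  by rewrite (le_trans (lerXn2r _ _ _ xy)) ?nnegrE// ?(le_trans _ xy)// lerDl.
have hu : (sqint u < (e / (2 * 2))%:E)%E.
  apply: (@le_lt_trans _ _ ((M ^+ 2 + 1)%:E * sqint (g - b)%R)%E).
    apply: sqint_le => //; first exact: measurable_funB.
      exact: ltW.
    by move=> x; rewrite /u exprMn ler_wpM2r ?sqr_ge0// sqle.
  rewrite -lte_pdivlMl//; move: gb; congr (_ < _%:E)%E.
  by field; rewrite gt_eqF.
have hv : (sqint v < (e / (2 * 2))%:E)%E.
  apply: (@le_lt_trans _ _ ((N ^+ 2 + 1)%:E * sqint (f - a)%R)%E).
    apply: sqint_le => //; first exact: measurable_funB.
      exact: ltW.
    by move=> x; rewrite /v exprMn ler_wpM2r ?sqr_ge0// sqle.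
  by rewrite -lte_pdivlMl// -EFinM mulrC.
apply: le_lt_trans (lt_double _ hu hv) => //.
apply: sqint_leD => //.
  by apply: measurable_funB; exact: measurable_funM.
move=> x; rewrite !fctE; have := sqrD_le (u x) (v x).
by congr (_ ^+ 2 <= _); rewrite /u /v; ring.
Qed.

Lemma sq_approx_cst c : sq_approx (cst c).
Proof. by apply: sq_approx_A; exact: (A_cst A_alg). Qed.

Lemma sq_approxZ c f : sq_approx f -> sq_approx (c *: f).
Proof. by move=> hf; apply: (sq_approxM (sq_approx_cst c)) => //; exact: bmeas_cst. Qed.

Lemma sq_approx_sum (I : Type) (s : seq I) (h : I -> T -> R) :
  (forall i, sq_approx (h i)) -> sq_approx (\sum_(i <- s) h i).
Proof.
by move=> hh; apply: big_ind => //; [exact: sq_approx_cst | exact: sq_approxD].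
Qed.

(** Dominated convergence applied to the squared errors. *)
Lemma sq_approx_lim (h_ : nat -> T -> R) h (G : T -> R) :
  (forall k, sq_approx (h_ k)) -> measurable_fun setT h ->
  mu.-integrable setT (EFin \o G) ->
  (forall k x, (h x - h_ k x) ^+ 2 <= G x) ->
  (forall x, h_ ^~ x @ \oo --> h x) -> sq_approx h.
Proof.
move=> ah mh iG hG hcvg; apply: sq_approx_closed => // e e0.
have m_ k : measurable_fun setT (fun x => ((h x - h_ k x) ^+ 2)%:E).
  by apply: msq; apply: measurable_funB => //; exact: (ah k).1.
have ae1 : {ae mu, forall x, setT x ->
    (fun k => ((h x - h_ k x) ^+ 2)%:E) @ \oo --> (cst 0%E x : \bar R)}.
  apply: aeW => x _; apply: cvg_EFin; first exact: nearW.
  have hc : (fun k => h x - h_ k x) @ \oo --> h x - h x.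
    by apply: cvgB; [exact: cvg_cst | exact: hcvg].
  by have h0 := cvgM hc hc; rewrite subrr mulr0 in h0; exact: h0.
have ae2 : {ae mu, forall x k, setT x ->
    (`|((h x - h_ k x) ^+ 2)%:E| <= (EFin \o G) x)%E}.
  by apply: aeW => x k _; rewrite gee0_abs ?lee_fin// sqr_ge0.
have [_ _] := @dominated_convergence _ T R mu setT measurableT _ _ _
  m_ (measurable_cst _) ae1 iG ae2.
rewrite integral0 => /fine_cvgP[] /= fn /cvgrPdist_lt/(_ _ e0) fc.
near \oo => k.
exists (h_ k) => //.
have kfin : (\int[mu]_x ((h x - h_ k x) ^+ 2)%:E)%E \is a fin_num by near: k.
have : `|0 - fine (\int[mu]_x ((h x - h_ k x) ^+ 2)%:E)%E| < e by near: k.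
rewrite sub0r normrN; move=> /(le_lt_trans (ler_norm _)).
by rewrite -lte_fin fineK.
Unshelve. all: by end_near. Qed.

Lemma sq_approx_bounded_lim (h_ : nat -> T -> R) h (M : R) :
  (forall k, sq_approx (h_ k)) -> (forall k x, `|h_ k x| <= M) ->
  (forall x, h_ ^~ x @ \oo --> h x) -> sq_approx h.
Proof.
move=> ah hM hcvg.
have mh : measurable_fun setT h.
  by apply: (measurable_fun_cvg (fun k => (ah k).1)) => x _; exact: hcvg.
apply: (@sq_approx_lim h_ h (fun=> (M + M) ^+ 2)) => //.
  by apply: bmeas_integrable => //; exact: bmeas_cst.
move=> k x; rewrite -(real_normK (num_real (_ - _))).
have hx : `|h x| <= M.
  have hc : (fun k => `|h_ k x|) @ \oo --> `|h x| by apply: cvg_norm; exact: hcvg.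
  rewrite -(cvg_lim _ hc)//; apply: limr_le; last exact: nearW.
  by apply/cvg_ex; exists `|h x|.
have M0 : 0 <= M by apply: le_trans hx.
by rewrite lerXn2r ?nnegrE ?addr_ge0// (le_trans (ler_normB _ _))// lerD.
Qed.

(* The iterates of (3 s - s ^ 3) / 2 converge to the sign of s on [-1, 1]. *)
Definition sgn_step (s : R) := 2^-1 * (3 * s - s ^+ 3).

Let sgn_step_le1 s : `|s| <= 1 -> `|sgn_step s| <= 1.
Proof.
rewrite !ler_norml /sgn_step => /andP[h1 h2]; apply/andP; split; rewrite -subr_ge0.
  have -> : 2^-1 * (3 * s - s ^+ 3) - -1 = 2^-1 * ((1 + s) ^+ 2 * (2 - s)) by field.
  by rewrite mulr_ge0// mulr_ge0 ?sqr_ge0//; lra.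
have -> : 1 - 2^-1 * (3 * s - s ^+ 3) = 2^-1 * ((1 - s) ^+ 2 * (2 + s)) by field.
by rewrite mulr_ge0// mulr_ge0 ?sqr_ge0//; lra.
Qed.

(** A step multiplies the distance of [y] to 1 by [1 - y / 2 - y ^+ 2 / 2]; the iterates never drop
    below [s], so this factor is at most [1 - s / 2]. *)
Let iter_sgn_step_pos s k : 0 < s <= 1 ->
  s <= iter k sgn_step s <= 1 /\ 1 - iter k sgn_step s <= (1 - s / 2) ^+ k.
Proof.
move=> /andP[s0 s1]; elim: k => [|k [/andP[IH1 IH2] IH3]] /=.
  by rewrite lexx s1 expr0; split=> //; rewrite gerBl ltW.
set y := iter k sgn_step s in IH1 IH2 IH3 *.
have y0 : 0 < y by apply: lt_le_trans IH1.
have h1 : 1 - sgn_step y = (1 - y) * (2^-1 * ((1 - y) * (2 + y))).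
  by rewrite /sgn_step; field.
have h2 : sgn_step y - y = 2^-1 * (y * ((1 - y) * (1 + y))).
  by rewrite /sgn_step; field.
have h3 : 0 <= 2^-1 * ((1 - y) * (2 + y)).
  by rewrite mulr_ge0// mulr_ge0//; lra.
split.
  apply/andP; split; last by rewrite -subr_ge0 h1 mulr_ge0//; lra.
  apply: (le_trans IH1); rewrite -subr_ge0 h2 mulr_ge0// mulr_ge0//; first exact: ltW.
  by rewrite mulr_ge0//; lra.
rewrite h1 exprSr ler_pM//; first lra.
have : 0 <= y * y by rewrite mulr_ge0 ?ltW.
have -> : 2^-1 * ((1 - y) * (2 + y)) = 1 - y / 2 - y * y / 2 by field.
lra.
Qed.

Let iter_sgn_stepN s k : iter k sgn_step (- s) = - iter k sgn_step s.
Proof. by elim: k => //= k ->; rewrite /sgn_step; ring. Qed.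

Let iter_sgn_step_cvg s : `|s| <= 1 ->
  (fun k => iter k sgn_step s) @ \oo --> Num.sg s.
Proof.
have pos x : 0 < x <= 1 -> (fun k => iter k sgn_step x) @ \oo --> (1 : R).
  move=> hx; have /andP[x0 x1] := hx.
  apply: (@squeeze_cvgr _ _ _ _ (fun k => 1 - (1 - x / 2) ^+ k) (fun=> 1)).
  - apply: nearW => k; have [/andP[_ h1] h2] := iter_sgn_step_pos k hx.
    by rewrite h1 andbT lerBlDr addrC -lerBlDr.
  - rewrite -[X in _ --> X]subr0; apply: cvgB; first exact: cvg_cst.
    by apply: cvg_expr; rewrite ger0_norm; lra.
  - exact: cvg_cst.
case: (ltgtP s 0) => [s0|s0|->] s1.
- rewrite ltr0_sg//; rewrite ltr0_norm// in s1.
  have := pos (- s); rewrite oppr_gt0 s0 s1 => /(_ isT) h.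
  rewrite (_ : (fun k => _) = (fun k => - iter k sgn_step (- s))); first exact: cvgN.
  by apply/funext => k; rewrite iter_sgn_stepN opprK.
- by rewrite gtr0_sg//; apply: pos; rewrite s0 -(gtr0_norm s0).
- rewrite sgr0 (_ : (fun k => _) = fun=> 0); first exact: cvg_cst.
  by apply/funext; elim=> //= k ->; rewrite /sgn_step; ring.
Qed.

(** After scaling [f] into [-1, 1], the iterates of [sgn_step] are uniformly bounded polynomials in
    [f] that converge to its sign. *)
Lemma sq_approx_sg f : sq_approx f -> bmeas f -> sq_approx (fun x => Num.sg (f x)).
Proof.
move=> af bf; have [_ [M hM]] := bf.
pose c := (`|M| + 1)^-1.
have M1 : 0 < `|M| + 1 by rewrite ltr_wpDl.
have c0 : 0 < c by rewrite invr_gt0.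
have fc1 x : `|c * f x| <= 1.
  rewrite normrM gtr0_norm// mulrC ler_pdivrMr// mul1r.
  by rewrite (le_trans (hM x))// (le_trans (ler_norm M))// lerDl.
pose h_ k : T -> R := fun x => iter k sgn_step (c * f x).
have ah k : sq_approx (h_ k) /\ bmeas (h_ k).
  elim: k => [|k [IH1 IH2]].
    by split; [exact: (sq_approxZ c af) | exact: bmeasZ].
  have -> : h_ k.+1 = 2^-1 *: (3 *: h_ k + (-1) *: (h_ k * (h_ k * h_ k))).
    by apply/funext => x; rewrite /h_ /= /sgn_step !fctE /GRing.scale /=; ring.
  split.
    apply: sq_approxZ; apply: sq_approxD; apply: sq_approxZ => //.
    by apply: sq_approxM => //; exact: sq_approxM.
  apply: bmeasZ; apply: bmeasD; apply: bmeasZ => //.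
  by apply: bmeasM => //; exact: bmeasM.
apply: (@sq_approx_bounded_lim h_ _ 1) => [k|k x|x].
- exact: (ah k).1.
- rewrite /h_; elim: k => [|k IH] /=; first exact: fc1.
  exact: sgn_step_le1.
- have -> : Num.sg (f x) = Num.sg (c * f x) by rewrite sgrM (gtr0_sg c0) mul1r.
  exact: iter_sgn_step_cvg.
Qed.

Definition sq_approx_sets : set (set T) := [set E | measurable E /\ sq_approx \1_E].

(** The indicator of [y > 0] is [(sg y ^+ 2 + sg y) / 2]. *)
Lemma sq_approx_pos f : sq_approx f -> bmeas f ->
  sq_approx_sets [set x | 0 < f x].
Proof.
move=> af bf; split.
  have := bf.1 measurableT `]0, +oo[%classic (measurable_itv _).
  by rewrite setTI; congr measurable; apply/funext => x; rewrite /= in_itv /= andbT.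
have ag := sq_approx_sg af bf.
have bg : bmeas (fun x => Num.sg (f x)).
  split; first exact: ag.1.
  by exists 1 => x; rewrite normr_sg; case: (_ == _).
have := sq_approxZ 2^-1 (sq_approxD (sq_approxM ag bg ag) ag).
congr sq_approx; apply/funext => x; rewrite !fctE /GRing.scale /= indicE.
case: (ltgtP (f x) 0) => [fx|fx|fx].
- by rewrite memNset /= ?ltr0_sg//; [ring | apply/negP; rewrite -leNgt ltW].
- by rewrite mem_set//= gtr0_sg//; field.
- by rewrite fx memNset /= ?sgr0; [ring | apply/negP; rewrite fx ltxx].
Qed.

Let bmeas_ind E : sq_approx_sets E -> bmeas (\1_E : T -> R).
Proof. by move=> [mE _]; exact: bmeas_indic. Qed.

Lemma sq_approx_sigma_algebra : sigma_algebra setT sq_approx_sets.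
Proof.
split.
- split=> //; rewrite indic0; exact: (sq_approx_cst 0).
- move=> E [mE aE]; rewrite setTD; split; first exact: measurableC.
  have := sq_approxD (sq_approx_cst 1) (sq_approxZ (-1) aE).
  congr sq_approx; apply/funext => x; rewrite !fctE /GRing.scale /= !indicE in_setC.
  by case: (x \in E) => /=; ring.
- move=> F hF; split; first by apply: bigcupT_measurable => k; exact: (hF k).1.
  (* The indicator of the union of the first [k] sets, written through the product of the indicators
     of the complements. *)
  pose h_ k : T -> R := 1 + (-1) *: \prod_(i < k) (1 + (-1) *: \1_(F i)).
  have term i : sq_approx (1 + (-1) *: \1_(F i)) /\ bmeas (1 + (-1) *: \1_(F i) : T -> R).
    split.
      apply: sq_approxD; first exact: (sq_approx_cst 1).
      by apply: sq_approxZ; exact: (hF i).2.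
    by apply: bmeasD; [exact: (bmeas_cst _ 1) | apply: bmeasZ; exact: bmeas_ind].
  have prodE k x : (\prod_(i < k) (1 + (-1) *: \1_(F i)) : T -> R) x =
      if x \in \bigcup_(i < k) F i then 0 else 1.
    rewrite fct_prodE; case: ifPn => [/set_mem[i /= ik Fi]|/negP hx].
      rewrite (bigD1 (Ordinal ik))//= !fctE /GRing.scale /= indicE mem_set//.
      by rewrite -[(1 : T -> R) x]/(1 : R) mulr1 subrr mul0r.
    rewrite big1// => i _; rewrite !fctE /GRing.scale /= indicE memNset ?mulr0//.
      by rewrite -[(1 : T -> R) x]/(1 : R) addr0.
    by move=> Fi; apply: hx; apply/mem_set; exists (i : nat) => //=.
  have hE k x : h_ k x = \1_(\bigcup_(i < k) F i) x.
    rewrite /h_ !fctE /GRing.scale /= prodE indicE -[(1 : T -> R) x]/(1 : R).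
    by case: (x \in _) => /=; ring.
  apply: (@sq_approx_bounded_lim h_ _ 1) => [k|k x|x].
  + apply: sq_approxD; first exact: (sq_approx_cst 1).
    apply: sq_approxZ; elim: k {hE} => [|k IH].
      by rewrite big_ord0; exact: (sq_approx_cst 1).
    rewrite big_ord_recr /= mulrC; apply: sq_approxM => //; first exact: (term k).1.
    exact: (term k).2.
  + by rewrite hE indicE; case: (_ \in _); rewrite ?normr1// normr0.
  + apply: cvg_near_cst; rewrite indicE.
    case: (boolP (x \in \bigcup_k F k)) => [/set_mem[i _ Fi]|/negP nF].
      exists i.+1 => // k /= ik; rewrite hE indicE mem_set//; by exists i.
    apply: nearW => k; rewrite hE indicE memNset//= => -[i _ Fi].
    by apply: nF; apply/mem_set; exists i.
Qed.

Lemma sq_approx_nnsfun (s : {nnsfun T >-> R}) :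
  (forall E, measurable E -> sq_approx \1_E) -> sq_approx s.
Proof.
move=> hE.
have -> : (s : T -> R) = \sum_(y <- finmap.enum_fset (fset_set (range s)))
    y *: \1_(s @^-1` [set y]).
  apply/funext => x; rewrite fimfunE fsbig_finite//= fct_sumE.
  by apply: eq_bigr.
by apply: sq_approx_sum => y; apply: sq_approxZ; exact: hE.
Qed.

(** Increasing simple functions converge to [g], with squared errors dominated by [g ^+ 2]. *)
Lemma sq_approx_ge0 g : (forall E, measurable E -> sq_approx \1_E) ->
  measurable_fun setT g -> (forall x, 0 <= g x) -> (sqint g < +oo)%E -> sq_approx g.
Proof.
move=> hE mg g0 ig.
have mgE : measurable_fun setT (EFin \o g) by exact/measurable_EFinP.
pose s k := nnsfun_approx measurableT mgE k.
have s_cvg x : (fun k => s k x) @ \oo --> g x.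
  have := cvg_nnsfun_approx measurableT mgE (fun y _ => g0 y) (x := x) I.
  by move=> /fine_cvgP[].
have s_le k x : s k x <= g x.
  have s_nd : {homo (fun k => s k x) : i j / (i <= j)%N >-> i <= j}.
    by move=> i j ij; exact/lefP/nd_nnsfun_approx.
  rewrite -(cvg_lim _ (s_cvg x))//; apply: nondecreasing_cvgn_le => //.
  by apply/cvg_ex; exists (g x).
apply: (@sq_approx_lim (fun k => s k) g (fun x => g x ^+ 2)) => //.
- by move=> k; exact: sq_approx_nnsfun.
- apply/integrableP; split; first exact: msq.
  move: ig; congr (_ < _)%E; apply: eq_integral => x _.
  by rewrite /= ger0_norm// sqr_ge0.
- move=> k x; rewrite lerXn2r ?nnegrE ?subr_ge0 ?s_le//.
  by rewrite gerBl fun_ge0.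
Qed.

Lemma sq_approx_all g : (forall E, measurable E -> sq_approx \1_E) ->
  measurable_fun setT g -> (sqint g < +oo)%E -> sq_approx g.
Proof.
move=> hE mg ig.
(* The values 1 and -1 of [c] give the positive and the negative part of [g]. *)
have part (c : R) : `|c| = 1 -> sq_approx (fun x => Num.max (c * g x) 0).
  move=> c1; apply: sq_approx_ge0 => //.
  - apply: measurable_maxr; last exact: measurable_cst.
    by apply: measurable_funM => //; exact: measurable_cst.
  - by move=> x; rewrite le_max lexx orbT.
  apply: le_lt_trans ig.
  rewrite -[leRHS]mul1e; apply: sqint_le => //.
    apply: measurable_maxr; last exact: measurable_cst.
    by apply: measurable_funM => //; exact: measurable_cst.
  move=> x; rewrite mul1r -[leRHS]real_normK ?num_real// -(mul1r `|g x|) -c1 -normrM.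
  rewrite real_normK ?num_real//; case: (ltP (c * g x) 0) => // _.
  by rewrite expr0n sqr_ge0.
have := sq_approxD (part 1 (normr1 _)) (sq_approxZ (-1) (part (-1) (normrN1 _))).
congr sq_approx; apply/funext => x; rewrite !fctE /GRing.scale /= !mulN1r mul1r.
have [h|h] := leP (g x) 0.
  by rewrite max_l ?oppr_ge0//; ring.
by rewrite max_r ?oppr_le0 ?ltW//; ring.
Qed.

End SquareApproximation.

(** * Density, uniqueness and support *)

Section RealL2.
Variables (R : realType) (n : nat).
Local Notation V := 'rV[R]_n.
Local Notation B := (borelRn R n).
Variable mu : {measure set B -> \bar R}.

Lemma L2normE (F : V -> R[i]) : complex_measurable F ->
  L2norm mu F = sqrte (sqint mu (fun t => complex.Re (F t)) +
                       sqint mu (fun t => complex.Im (F t)))%E.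
Proof.
move=> [mr mi].
have msq (f : B -> R) : measurable_fun setT f ->
    measurable_fun setT (fun t => ((f t) ^+ 2)%:E).
  by move=> mf; apply/measurable_EFinP; exact: measurable_funX.
rewrite /sqint -ge0_integralD//; try exact: msq;
  try by move=> t _; rewrite lee_fin sqr_ge0.
rewrite /L2norm Lnorm.unlock poweR12_sqrt; last first.
  by apply: integral_ge0 => t _; exact: poweR_ge0.
congr sqrte; apply: eq_integral => t _; rewrite -EFinD abse_EFin poweR_EFin.
congr EFin; case: (F t) => a b /=.
rewrite ger0_norm ?sqrtr_ge0// powR_mulrn ?sqrtr_ge0// sqr_sqrtr//.
by rewrite addr_ge0 ?sqr_ge0.
Qed.

Lemma sqrte_lt (x : \bar R) (e : R) : 0 < e -> (0 <= x)%E -> (x < (e ^+ 2)%:E)%E ->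
  (sqrte x < e%:E)%E.
Proof.
case: x => // r e0 r0; rewrite !lte_fin => re.
by rewrite -(gtr0_norm e0) -sqrtr_sqr ltr_sqrt// exprn_gt0.
Qed.

Lemma sqrte_lty (x : \bar R) : (sqrte x < +oo)%E -> (x < +oo)%E.
Proof. by case: x => // r _; exact: ltry. Qed.

Lemma L2P (F : V -> R[i]) : L2 mu F <-> complex_measurable F /\
  (sqint mu (fun t => complex.Re (F t)) < +oo)%E /\
  (sqint mu (fun t => complex.Im (F t)) < +oo)%E.
Proof.
split=> [[mF]|[mF [h1 h2]]].
  rewrite L2normE// => /sqrte_lty h; split=> //; split; apply: le_lt_trans h.
    by rewrite leeDl// sqint_ge0.
  by rewrite leeDr// sqint_ge0.
split=> //; rewrite L2normE//.
have : (sqint mu (fun t => complex.Re (F t)) +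
        sqint mu (fun t => complex.Im (F t)) < +oo)%E by exact: lte_add_pinfty.
by case: (_ + _)%E => //= r _; exact: ltry.
Qed.

End RealL2.

(** * Approximation of Borel sets by bounded elements of the algebra *)

Section ThetaDensity.
Variables (R : realType) (n m : nat) (p : m.-tuple (mpoly.mpoly n R)).
Local Notation V := 'rV[R]_n.
Local Notation B := (borelRn R n).

Definition bounded_theta_funs : set (B -> R) := theta_fun p 0.

Lemma bounded_theta_funs_bmeas a : bounded_theta_funs a -> bmeas a.
Proof.
move=> ha; split; first by apply: (@measurable_theta_funs _ _ _ p); exists 0%N.
have [q hq aq] := ha; have [M hM] := polyf_bounded hq.
by exists M => t; rewrite aq mul1r hM// => i; exact: boxed01.
Qed.

Lemma bounded_theta_funs_alg : real_subalgebra bounded_theta_funs.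
Proof.
split=> [c|f g|f g].
- exact: (theta_fun_poly p 0 (polyf_cst _ c)).
- exact: theta_funD.
- exact: (@theta_funM _ _ _ p 0 0).
Qed.

(** This function has the sign of [t_j - b], and the factor [theta] makes it a polynomial in the
    bounded coordinates. *)
Lemma bounded_theta_funs_halfspace j b :
  bounded_theta_funs (fun t => theta p t * ((t : V) ord0 j - b)).
Proof.
pose q (x : 'I_n.+1 -> R) := x (lift ord0 j) + - 2^-1 + (- b) * x ord0.
have hq : polyf q.
  apply: polyfD; last by apply: polyfZ; exact: polyf_var.
  by apply: polyfD; [exact: polyf_var | exact: polyf_cst].
exists q => // t; rewrite mul1r /q boxedS boxed0; ring.
Qed.

Variable mu : {measure set B -> \bar R}.
Hypothesis mufin : (mu setT < +oo)%E.

(** The approximable sets form a sigma-algebra containing the half spaces. That it contains all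
    Borel sets is expressed as measurability of the identity map, checked coordinate by
    coordinate. *)
Lemma sq_approx_borel E : measurable E -> sq_approx mu bounded_theta_funs \1_E.
Proof.
move=> mE.
have sD := sq_approx_sigma_algebra mufin bounded_theta_funs_bmeas bounded_theta_funs_alg.
set D := sq_approx_sets mu bounded_theta_funs in sD.
pose T' := g_sigma_algebraType D.
have DE : @measurable _ T' = D by exact: (measurable_g_measurableTypeE sD).
have mid : measurable_fun setT ((fun x => x) : T' -> B).
  apply: measurable_fun_rV => j.
  apply: (measurability _ (RGenOInfty.measurableE R)) => _ [_ [b ->] <-].
  rewrite setTI DE.
  have hf := bounded_theta_funs_halfspace j b.
  have := sq_approx_pos mufin bounded_theta_funs_bmeas bounded_theta_funs_alg
    (sq_approx_A mu bounded_theta_funs_bmeas hf) (bounded_theta_funs_bmeas hf).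
  congr D; apply/funext => t /=.
  by rewrite in_itv /= andbT pmulr_rgt0 ?theta_gt0// subr_gt0.
have := mid measurableT E mE; rewrite setTI preimage_id DE.
by case.
Qed.

End ThetaDensity.

Section SmallSquare.
Context d (T : measurableType d) (R : realType).
Variable mu : {measure set T -> \bar R}.
Hypothesis mufin : (mu setT < +oo)%E.

(** The pointwise bound [f <= f ^+ 2 / e + e] integrates to a bound linear in [e]. *)
Lemma Rintegral_le_sqint f (e : R) : 0 < e -> bmeas f ->
  (sqint mu f < (e ^+ 2)%:E)%E -> \int[mu]_x f x <= e * (fine (mu setT) + 1).
Proof.
move=> e0 bf hf.
have i2 := bmeas_integrable mufin (bmeasX 2 bf).
have h2 : \int[mu]_x (f x ^+ 2) <= e ^+ 2.
  by rewrite -lee_fin /Rintegral fineK ?ltW//; exact: integrable_fin_num.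
(* AM-GM *)
apply: (@le_trans _ _ (\int[mu]_x (e^-1 * f x ^+ 2 + e))).
  apply: le_Rintegral => //; first exact: bmeas_integrable.
    apply: bmeas_integrable => //; apply: bmeasD; last exact: bmeas_cst.
    by apply: bmeasZ; exact: bmeasX.
  move=> x _; rewrite -subr_ge0.
  have -> : e^-1 * f x ^+ 2 + e - f x =
      e^-1 * ((f x - e / 2) ^+ 2 + 3 / 4 * e ^+ 2) by field; rewrite gt_eqF.
  by rewrite mulr_ge0 ?invr_ge0 ?(ltW e0)// addr_ge0 ?sqr_ge0// mulr_ge0// sqr_ge0.
rewrite RintegralD//; last 2 first.
- by apply: bmeas_integrable => //; apply: bmeasZ; exact: bmeasX.
- by apply: bmeas_integrable => //; exact: bmeas_cst.
rewrite RintegralZ// Rintegral_cst// mulrDr mulr1 addrC lerD2l.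
by rewrite ler_pdivrMl// -expr2.
Qed.

End SmallSquare.

Section MpolyContinuity.
Variables (R : realType) (n : nat).
Local Notation V := 'rV[R]_n.

Lemma continuous_mpoly (q : mpoly.mpoly n R) : continuous (real_mpoly_fun q).
Proof.
have csum (I : Type) (s : seq I) (h : I -> V -> R) :
    (forall i, continuous (h i)) -> continuous (fun t => \sum_(i <- s) h i t).
  move=> hh; elim: s => [|i s IH] t.
    have -> : (fun t => \sum_(i <- [::]) h i t) = cst 0.
      by apply/funext => t'; rewrite big_nil.
    exact: cst_continuous.
  have -> : (fun t => \sum_(j <- i :: s) h j t) = fun t => h i t + \sum_(j <- s) h j t.
    by apply/funext => t'; rewrite big_cons.
  exact: (cvgD (hh i t) (IH t)).
have cprod (I : Type) (s : seq I) (h : I -> V -> R) :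
    (forall i, continuous (h i)) -> continuous (fun t => \prod_(i <- s) h i t).
  move=> hh; elim: s => [|i s IH] t.
    have -> : (fun t => \prod_(i <- [::]) h i t) = cst 1.
      by apply/funext => t'; rewrite big_nil.
    exact: cst_continuous.
  have -> : (fun t => \prod_(j <- i :: s) h j t) = fun t => h i t * \prod_(j <- s) h j t.
    by apply/funext => t'; rewrite big_cons.
  exact: (cvgM (hh i t) (IH t)).
have -> : real_mpoly_fun q = (fun t : V => \sum_(w <- mpoly.msupp q)
    mpoly.mcoeff w q * \prod_i t ord0 i ^+ mpoly.fun_of_multinom w i).
  by apply/funext => t; rewrite /real_mpoly_fun mpoly.mevalE.
apply: csum => w t.
have cw : continuous (fun t : V => \prod_i t ord0 i ^+ mpoly.fun_of_multinom w i).
  apply: cprod => i {}t.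
  exact: (continuous_comp (@coord_continuous _ _ _ ord0 i t) (@exprn_continuous R _ _)).
exact: (cvgM (cvg_cst _) (cw t)).
Qed.

End MpolyContinuity.

(** * Representing measures of [Lambda] *)

Section Representation.
Variables (R : realType) (n m : nat) (p : m.-tuple (mpoly.mpoly n R)).
Local Notation V := 'rV[R]_n.
Local Notation B := (borelRn R n).
Variable Lambda : (V -> R[i]) -> R[i].
Hypothesis hpsd : psd_map (R_theta p) Lambda.
Hypothesis hpos : forall (k : 'I_m) (r : V -> R[i]), R_theta p r ->
  0 <= Lambda (fun t => (real_mpoly_fun (tnth p k) t)%:C * `|r t| ^+ 2).

Let l := real_functional Lambda.

Let AA := theta_funs_alg p.

Lemma representing_functional (nu : {measure set B -> \bar R}) f :
  representing_measure (R_theta p) Lambda nu -> theta_funs p f ->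
  \int[nu]_t f t = l f.
Proof.
move=> [_ hnu] hf; rewrite /l /real_functional hnu; last exact: R_theta_cplx.
by rewrite /complex_integral.
Qed.

(** The constant 1 is in the algebra, hence square integrable. *)
Lemma representing_finite (nu : {measure set B -> \bar R}) :
  representing_measure (R_theta p) Lambda nu -> (nu setT < +oo)%E.
Proof.
move=> [hL2 _]; have A1 : theta_funs p (cst 1) by exact: (A_cst AA).
have /L2P[_ [h _]] := hL2 _ (R_theta_cplx A1).
move: h; rewrite /sqint; under eq_integral do rewrite /= expr1n.
by rewrite integral_cst// mul1e.
Qed.

(** An element [a] close to the indicator of [X] for the sum of both measures is close for each of
    them, and its two integrals agree with [l a]. The hypotheses being symmetric, an inequality
    suffices for uniqueness. *)
Lemma representing_measure_le (mu nu : {measure set B -> \bar R}) :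
  representing_measure (R_theta p) Lambda mu ->
  representing_measure (R_theta p) Lambda nu ->
  forall X, measurable X -> (mu X <= nu X)%E.
Proof.
move=> hmu hnu X mX.
have mufin := representing_finite hmu; have nufin := representing_finite hnu.
have finE (rho : {measure set B -> \bar R}) : (rho setT < +oo)%E -> rho X \is a fin_num.
  move=> h; rewrite ge0_fin_numE// (le_lt_trans _ h)//.
  by apply: le_measure => //; rewrite inE.
rewrite -[mu X]fineK ?finE// -[nu X]fineK ?finE// lee_fin.
apply/ler_addgt0Pr => e e0.
pose C := fine (mu setT) + 1 + (fine (nu setT) + 1).
(* With [d = e / C] the errors for the two measures add up to [e]. *)
have C0 : 0 < C by rewrite addr_gt0// ltr_wpDl// fine_ge0.
pose d := e / C; have d0 : 0 < d by rewrite divr_gt0.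
pose rho : {measure set B -> \bar R} := measure_add mu nu.
have rhofin : (rho setT < +oo)%E
  by rewrite [X in (X < _)%E](measure_addE mu nu setT) lte_add_pinfty.
have [_ /(_ (d ^+ 2)) []] := sq_approx_borel p rhofin mX.
  by rewrite exprn_gt0.
move=> a Aa ha; have ba := bounded_theta_funs_bmeas Aa.
have bX : bmeas (\1_X : B -> R) by exact: bmeas_indic.
have Ta : theta_funs p a by exists 0%N.
have bXa : bmeas (\1_X - a : B -> R) by exact: bmeasB.
have baX : bmeas (a - \1_X : B -> R) by exact: bmeasB.
have msq (f : B -> R) : bmeas f -> measurable_fun setT (fun t => ((f t) ^+ 2)%:E).
  by move=> [mf _]; apply/measurable_EFinP; exact: measurable_funX.
move: ha; rewrite /sqint ge0_integral_measure_add//; last 2 first.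
- by move=> t _; rewrite lee_fin sqr_ge0.
- exact: msq.
rewrite -!/(sqint _ _) => ha.
have hmu1 : (sqint mu (\1_X - a)%R < (d ^+ 2)%:E)%E.
  by apply: le_lt_trans ha; rewrite leeDl// sqint_ge0.
have hnu1 : (sqint nu (a - \1_X)%R < (d ^+ 2)%:E)%E.
  apply: le_lt_trans ha; rewrite (_ : sqint nu (a - \1_X)%R = sqint nu (\1_X - a)%R).
    by rewrite leeDr// sqint_ge0.
  by apply: eq_integral => t _; rewrite !fctE -opprB sqrrN.
have i1 := Rintegral_le_sqint mufin d0 bXa hmu1.
have i2 := Rintegral_le_sqint nufin d0 baX hnu1.
have e1 : \int[mu]_t (\1_X - a : B -> R) t = fine (mu X) - l a.
  rewrite -(representing_functional hmu Ta) -(Rintegral_indic mu mX).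
  by rewrite -RintegralB//; exact: bmeas_integrable.
have e2 : \int[nu]_t (a - \1_X : B -> R) t = l a - fine (nu X).
  rewrite -(representing_functional hnu Ta) -(Rintegral_indic nu mX).
  by rewrite -RintegralB//; exact: bmeas_integrable.
rewrite e1 in i1; rewrite e2 in i2.
have -> : e = d * (fine (mu setT) + 1) + d * (fine (nu setT) + 1).
  by rewrite -mulrDr /d divfK// gt_eqF.
lra.
Qed.

Lemma representing_exists : exists mu : {measure set B -> \bar R},
  representing_measure (R_theta p) Lambda mu.
Proof.
have [mu [mufin hmu]] := theta_funs_representation (real_functional_pos hpsd).
exists mu; split=> [F SF|F SF]; have [hr hi] := R_theta_ReIm SF; last first.
  by rewrite (LambdaE hpsd SF) /complex_integral !(hmu _ _).2.
(* The square of an element of the algebra is again in the algebra, hence integrable. *)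
have sq f : theta_funs p f -> (sqint mu f < +oo)%E.
  move=> hf; have /integrableP[_] := (hmu _ (A_exp AA 2 hf)).1.
  congr (_ < _)%E; apply: eq_integral => t _.
  by rewrite /= ger0_norm// sqr_ge0.
apply/L2P; split; last by split; exact: sq.
by split; exact: (measurable_theta_funs (p := p)).
Qed.

Lemma representing_dense (mu : {measure set B -> \bar R}) :
  representing_measure (R_theta p) Lambda mu -> dense_in_L2 mu (R_theta p).
Proof.
move=> hmu; have mufin := representing_finite hmu.
have [hL2 _] := hmu; split=> // G /L2P[[mr mi] [hr hi]] e e0.
(* Real and imaginary parts are approximated separately, each with half of the squared error. *)
have e2 : 0 < e ^+ 2 / 2 by rewrite divr_gt0// exprn_gt0.
have app (g : B -> R) : measurable_fun setT g -> (sqint mu g < +oo)%E ->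
    sq_approx mu (bounded_theta_funs p) g.
  apply: sq_approx_all => [a||E mE].
  - exact: bounded_theta_funs_bmeas.
  - exact: bounded_theta_funs_alg.
  - exact: sq_approx_borel.
have [_ /(_ _ e2)[a Aa ha]] := app _ mr hr.
have [_ /(_ _ e2)[b Ab hb]] := app _ mi hi.
have Ta : theta_funs p a by exists 0%N.
have Tb : theta_funs p b by exists 0%N.
pose F : V -> R[i] := fun t => Complex 0 1 * cplx b t + cplx a t.
have SF : R_theta p F.
  case: (generated_algebraP (polynomial_functions (n:=n) `|`
    [set (fun t => (theta p t)%:C)])) => _ SD _.
  by apply: SD; exact: R_theta_cplx.
exists F => //.
have ReF t : complex.Re (G t - F t) = complex.Re (G t) - a t.
  by rewrite /F /cplx; case: (G t) => x y /=; ring.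
have ImF t : complex.Im (G t - F t) = complex.Im (G t) - b t.
  by rewrite /F /cplx; case: (G t) => x y /=; ring.
have [ma _] := bounded_theta_funs_bmeas Aa.
have [mb _] := bounded_theta_funs_bmeas Ab.
have FE1 : (fun t => complex.Re (G t - F t)) = (fun t => complex.Re (G t)) - a.
  by apply/funext.
have FE2 : (fun t => complex.Im (G t - F t)) = (fun t => complex.Im (G t)) - b.
  by apply/funext.
rewrite L2normE; last first.
  by split; rewrite ?FE1 ?FE2; exact: measurable_funB.
rewrite FE1 FE2; apply: sqrte_lt => //; first by rewrite adde_ge0// sqint_ge0.
by rewrite [e ^+ 2]splitr EFinD lteD.
Qed.

(** If [pk] were negative at a point of the support, the open set [U] where it is negative would
    have positive measure. Testing with [r = theta * a], for [a] close to the indicator of [U],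
    would then give a negative value. *)
Lemma representing_support (mu : {measure set B -> \bar R}) :
  representing_measure (R_theta p) Lambda mu ->
  msupport mu `<=` \bigcap_(k : 'I_m) (real_mpoly_fun (tnth p k) @^-1` [set x | 0 <= x]).
Proof.
move=> hmu x xsupp k _ /=; have mufin := representing_finite hmu.
rewrite leNgt; apply/negP => px0.
pose pk := real_mpoly_fun (tnth p k); pose U : set B := [set t | pk t < 0].
have mpk : measurable_fun setT (pk : B -> R) by exact: measurable_mpoly.
have mU : measurable U.
  have := mpk measurableT `]-oo, 0[%classic (measurable_itv _).
  by rewrite setTI; congr measurable; apply/funext => t; rewrite /= in_itv.
have muU : (0 < mu U)%E.
  apply: xsupp => //; rewrite (_ : U = pk @^-1` [set y | y < 0])//.
  by apply: open_comp; [move=> t _; exact: continuous_mpoly | exact: open_lt].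
(* The weight [theta ^+ 2] makes [pk] bounded by 1, since [|pk| <= denom <= denom ^+ 2]. *)
pose w : B -> R := fun t => pk t * theta p t ^+ 2.
have w1 t : `|w t| <= 1.
  have pkD : `|pk t| <= denom p t.
    have : pk t ^+ 2 <= denom p t - 1.
      have h1 : 0 <= \sum_(j < n) (t : V) ord0 j ^+ 2.
        by apply: sumr_ge0 => i _; exact: sqr_ge0.
      have h2 : 0 <= \sum_(i < m | i != k) real_mpoly_fun (tnth p i) t ^+ 2.
        by apply: sumr_ge0 => i _; exact: sqr_ge0.
      by rewrite /denom (bigD1 k)//= -/(pk t); lra.
    rewrite -(real_normK (num_real (pk t))); have := sqr_ge0 (`|pk t| - 1).
    have := normr_ge0 (pk t); nra.
  rewrite /w thetaE normrM [X in _ * X]ger0_norm ?sqr_ge0// exprVn.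
  rewrite ler_pdivrMr ?exprn_gt0 ?denom_gt0//.
  rewrite mul1r (le_trans pkD)// expr2 ler_peMr ?denom_ge1//; exact/ltW/denom_gt0.
have bw : bmeas w.
  split; last by exists 1.
  by apply: measurable_funM => //; apply: measurable_funX; exact: measurable_theta.
have bU : bmeas (\1_U : B -> R) by exact: bmeas_indic.
pose s : B -> R := fun t => - w t * \1_U t.
have bs : bmeas s by apply: bmeasM => //; exact: bmeasN.
have s0 t : 0 <= s t.
  rewrite /s indicE; case: (boolP (t \in U)) => [/set_mem Ut|_]; last by rewrite mulr0.
  by rewrite mulr1 oppr_ge0 /w mulr_le0_ge0 ?sqr_ge0// ltW.
have is_ := bmeas_integrable mufin bs.
have d0 : 0 < \int[mu]_t s t.
  rewrite lt_def Rintegral_ge0 ?andbT//; apply/negP => /eqP i0.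
  have sabs : (\int[mu]_t `|(s t)%:E| = 0)%E.
    transitivity (\int[mu]_t (s t)%:E)%E.
      by apply: eq_integral => t _; rewrite gee0_abs// lee_fin.
    rewrite -[LHS]fineK; last exact: integrable_fin_num.
    by rewrite -[fine _]/(Rintegral mu setT s) i0.
  have ms : measurable_fun setT (fun t => (s t)%:E).
    by apply/measurable_EFinP; exact: bs.1.
  have [N [mN N0 hN]] := (ae_eq_integral_abs mu measurableT ms).1 sabs.
  move: muU; rewrite ltNge => /negP; apply; rewrite -N0.
  apply: le_measure; rewrite ?inE//.
  move=> t Ut; apply: hN => /= /(_ I) [] /eqP; apply/negP.
  rewrite /s indicE mem_set// mulr1 oppr_eq0 /w mulf_eq0 expf_eq0 /=.
  by rewrite (lt_eqF Ut) (gt_eqF (theta_gt0 p t)).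
(* An error below half the integral of [s] makes the integral of [g] negative in the final
   estimate. *)
have d2 : 0 < (\int[mu]_t s t) / 2 by rewrite divr_gt0.
have [_ /(_ _ d2)[a Aa ha]] := sq_approx_borel p mufin mU.
have ba := bounded_theta_funs_bmeas Aa.
have Ta : theta_funs p a by exists 0%N.
have Tta : theta_funs p (theta p * a) by apply: (A_mul AA) => //; exact: theta_funs_theta.
pose g : V -> R := pk * (theta p * a) ^+ 2.
have Tg : theta_funs p g.
  by apply: (A_mul AA); [exact: theta_funs_mpoly | exact: (A_exp AA)].
have g0 : 0 <= \int[mu]_t g t.
  rewrite (representing_functional hmu Tg) /l /real_functional.
  have := hpos k (R_theta_cplx Tta).
  rewrite (_ : (fun t => _) = cplx g); first by case: (Lambda _) => x1 y1 /andP[].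
  have normsq (y : R) : `|y%:C| ^+ 2 = (y ^+ 2)%:C :> R[i].
    by rewrite normc_def /= expr0n addr0 -rmorphXn /= sqr_sqrtr// sqr_ge0.
  apply/funext => t; rewrite /cplx normsq /g !fctE.
  by rewrite [RHS]rmorphM.
have wE t : w t * a t ^+ 2 = g t by rewrite /g /w !fctE; ring.
(* On [U], with [v = - w t] in [0, 1], the right side minus the left is [(1 - v) (1 - a) ^+ 2 + v (2
   a - 1) ^+ 2 / 2]; off [U] the claim reduces to [w t <= 1]. *)
have pt t : g t <= (- 2^-1) * s t + (\1_U t - a t) ^+ 2.
  rewrite -wE /s indicE; have := w1 t; rewrite ler_norml => /andP[w1a w1b].
  case: (boolP (t \in U)) => [/set_mem Ut|_] /=.
    have w0 : w t <= 0 by rewrite /w mulr_le0_ge0 ?sqr_ge0// ltW.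
    rewrite -subr_ge0.
    have -> : - 2^-1 * (- w t * 1) + (1 - a t) ^+ 2 - w t * a t ^+ 2 =
      (1 + w t) * (1 - a t) ^+ 2 + (- w t) * 2^-1 * (2 * a t - 1) ^+ 2 by field.
    by rewrite addr_ge0// mulr_ge0 ?sqr_ge0//; [lra | rewrite mulr_ge0//; lra].
  by rewrite !mulr0 add0r sub0r sqrrN ler_piMl ?sqr_ge0.
have bUa : bmeas (fun t => (\1_U t - a t) ^+ 2 : R) by apply: bmeasX; exact: bmeasB.
have iUa := bmeas_integrable mufin bUa.
have bg : bmeas (g : B -> R).
  rewrite (_ : g = fun t => w t * a t ^+ 2); last exact/funext.
  by apply: bmeasM => //; exact: bmeasX.
have small : \int[mu]_t (\1_U t - a t) ^+ 2 < (\int[mu]_t s t) / 2.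
  by rewrite -lte_fin /Rintegral fineK//; exact: integrable_fin_num.
have : \int[mu]_t g t <= - 2^-1 * \int[mu]_t s t + \int[mu]_t (\1_U t - a t) ^+ 2.
  rewrite -RintegralZ// -RintegralD//; last first.
    by apply: bmeas_integrable => //; exact: bmeasZ.
  apply: le_Rintegral => //; first exact: bmeas_integrable.
  by apply: bmeas_integrable => //; apply: bmeasD => //; exact: bmeasZ.
lra.
Qed.

End Representation.

Theorem theorem2p5 (R : realType) (n : nat) (hn : (1 <= n)%N)
    (m : nat) (p : m.-tuple (mpoly.mpoly n R))
    (Lambda : ('rV[R]_n -> R[i]) -> R[i])
    (hpsd : psd_map (R_theta p) Lambda)
    (hpos : forall (k : 'I_m) (r : 'rV[R]_n -> R[i]), R_theta p r ->
       0 <= Lambda (fun t => (real_mpoly_fun (tnth p k) t)%:C * `|r t| ^+ 2)) :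
  exists mu : {measure set (borelRn R n) -> \bar R},
    [/\ representing_measure (R_theta p) Lambda mu,
        forall nu : {measure set (borelRn R n) -> \bar R},
          representing_measure (R_theta p) Lambda nu ->
          forall X : set (borelRn R n), measurable X -> nu X = mu X,
        msupport mu `<=`
          \bigcap_(k : 'I_m) (real_mpoly_fun (tnth p k) @^-1` [set x | 0 <= x])
      & dense_in_L2 mu (R_theta p)].
Proof.
have [mu hmu] := representing_exists hpsd.
exists mu; split=> //.
- move=> nu hnu X mX; apply/eqP.
  by rewrite eq_le (representing_measure_le hnu hmu)// (representing_measure_le hmu hnu).
- exact: representing_support hmu.
- exact: representing_dense hmu.
Qed.
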